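(* Let $p\in\mathbb{R}$, $p\neq -n$. On the class of $C^2_+$ convex bodies $K$ in $\mathbb{R}^n$ with centroid at the origin, the functional $K\mapsto\omega^p_{m,k,\vec{i}}(K)$ is a valuation, is homogeneous of degree $n\frac{n-p}{n+p}-k$, and is invariant under rotations and reflections. That is: (1) $\omega^p_{m,k,\vec{i}}(K\cup L)+\omega^p_{m,k,\vec{i}}(K\cap L)=\omega^p_{m,k,\vec{i}}(K)+\omega^p_{m,k,\vec{i}}(L)$ whenever $K$, $L$, $K\cup L$, $K\cap L$ all belong to this class; (2) $\omega^p_{m,k,\vec{i}}(aK)=a^{n\frac{n-p}{n+p}-k}\,\omega^p_{m,k,\vec{i}}(K)$ for all $a>0$ and all $K$ in this class; (3) $\omega^p_{m,k,\vec{i}}(T(K))=\omega^p_{m,k,\vec{i}}(K)$ for every (linear) rotation or reflection $T$ of $\mathbb{R}^n$ and all $K$ in this class.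
   Context: A convex body is a compact convex subset of $\mathbb{R}^n$ ($n\ge 2$) with nonempty interior. It is $C^2_+$ if its boundary $\partial K$ is twice continuously differentiable with strictly positive Gauss curvature everywhere. For $x\in\partial K$, $N(x)$ is the outer unit normal, $k_1(x),\dots,k_{n-1}(x)$ are the principal curvatures, and $H_j=\binom{n-1}{j}^{-1}\sum_{1\le i_1<\dots<i_j\le n-1}k_{i_1}\cdots k_{i_j}$ for $1\le j\le n-1$; in particular $H_{n-1}$ is the Gauss curvature. $\mathcal{H}^{n-1}$ is the surface area measure on $\partial K$. Fix integers $k,m\ge 0$ and a sequence $\vec{i}=\{i_j\}_{j=0}^{n-1}$ of nonnegative integers with $i_1+2i_2+\cdots+(n-1)i_{n-1}=m$. For $p\neq -n$ the weighted $L_p$ affine surface area is $$\omega^p_{m,k,\vec{i}}(K)=\int_{\partial K}\frac{H_{n-1}(x)^{\frac{p}{n+p}}}{\langle x,N(x)\rangle^{\frac{n(p-1)}{n+p}}}\,\langle x,N(x)\rangle^{m-k}\prod_{j=1}^{n-1}\left\{\binom{n-1}{j}^{i_j}H_j(x)^{i_j}\right\}d\mathcal{H}^{n-1}(x).$$ *)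

(* Defs.v *)
From HB Require Import structures.
From mathcomp Require Import all_boot all_order all_algebra.
From mathcomp Require Import all_classical all_reals all_analysis.

Set Implicit Arguments.
Unset Strict Implicit.
Unset Printing Implicit Defensive.

Import Order.TTheory GRing.Theory Num.Theory.
Import numFieldNormedType.Exports.

Local Open Scope classical_set_scope.
Local Open Scope ring_scope.

(* Points of R^n are row vectors.  The library norm `|x| on 'rV[R]_n is the sup
   norm; it is used below only for topological notions, for which all norms
   agree, and every metric quantity goes through dot and enorm. *)

Definition dot (R : realType) (n : nat) (u v : 'rV[R]_n) : R :=
  \sum_(i < n) u 0 i * v 0 i.

Definition enorm (R : realType) (n : nat) (u : 'rV[R]_n) : R :=
  Num.sqrt (dot u u).

Definition caratheodory_measure (R : realType) (T : pointedType)
    (mu : {outer_measure set T -> \bar R}) :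
    {measure set (caratheodory_type mu) -> \bar R} :=
  [the measure _ _ of (mu : set (caratheodory_type mu) -> \bar R)].

(* Outer measure generated by assigning the weight w i to the set S i, for i in
   D.  A piece None of a cover is empty and has weight 0, so that finite covers
   are allowed. *)
Definition cover_outer (R : realType) (T I : Type) (D : set I) (S : I -> set T)
    (w : I -> \bar R) (A : set T) : \bar R :=
  ereal_inf [set (\sum_(k <oo) oapp w 0%E (F k))%E | F in
    [set F : nat -> option I |
      (forall k i, F k = Some i -> D i) /\
      A `<=` \bigcup_k oapp S set0 (F k)]].

Section CoverOuter.
Context {R : realType} {T I : Type} {D : set I} {S : I -> set T}.
Context {w : I -> \bar R}.
Hypothesis w_ge0 : forall i, D i -> (0 <= w i)%E.
Local Open Scope ereal_scope.

Local Notation mu := (cover_outer D S w).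

Let Cov (A : set T) := [set F : nat -> option I |
  (forall k i, F k = Some i -> D i) /\ A `<=` \bigcup_k oapp S set0 (F k)].

Let wF_ge0 A F k : Cov A F -> 0 <= oapp w 0 (F k).
Proof. by case=> + _; case E: (F k) => [i|]//= => /(_ k i E)/w_ge0. Qed.

Lemma cover_outer_ge0 A : 0 <= mu A.
Proof.
apply: le_ereal_inf_tmp => x [F CF <-{x}].
by apply: nneseries_ge0 => k _ _; exact: (wF_ge0 _ CF).
Qed.

Lemma cover_outer0 : mu set0 = 0.
Proof.
apply/eqP; rewrite eq_le cover_outer_ge0 andbT.
apply: ereal_inf_lbound; exists (fun=> None); first by split.
by rewrite eseries0.
Qed.

Lemma le_cover_outer : {homo mu : A B / A `<=` B >-> A <= B}.
Proof.
move=> A B AB; apply/ereal_inf_le_tmp => x [F [DF BF]] <-{x}.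
by exists F => //; split => //; exact: subset_trans BF.
Qed.

Lemma cover_outer_sigma_subadditive : sigma_subadditive mu.
Proof.
move=> A; have [[i ioo]|] := pselect (exists i, mu (A i) = +oo).
  rewrite (eseries_pinfty _ _ ioo) ?leey// => n _.
  by rewrite -ltNye (lt_le_trans _ (cover_outer_ge0 _)).
rewrite -forallNE => Aoo.
suff add2e (e : {posnum R}) :
    mu (\bigcup_n A n) <= \sum_(i <oo) mu (A i) + e%:num%:E.
  by apply/lee_addgt0Pr => _/posnumP[].
rewrite (le_trans _ (epsilon_trick _ _ _))//; last first.
  by move=> n; exact: cover_outer_ge0.
pose P n (B : nat -> option I) := Cov (A n) B /\
  \sum_(k <oo) oapp w 0 (B k) <= mu (A n) + (e%:num / (2 ^ n.+1)%:R)%:E.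
have [G PG] : {G : nat -> nat -> option I & forall n, P n (G n)}.
  apply: (@choice _ _ P) => n; rewrite /P /cover_outer.
  set V := (X in ereal_inf X); move infV : (ereal_inf V) => iV.
  case: iV infV => [r Sr|Soo|Soo].
  - have en1 : (0 < e%:num / (2 ^ n.+1)%:R)%R by [].
    have /(lb_ereal_inf_adherent en1) : ereal_inf V \is a fin_num by rewrite Sr.
    move=> [x [B CB muBx] xS].
    by exists B; split => //; rewrite muBx -Sr; exact/ltW.
  - by have := Aoo n; rewrite /cover_outer Soo.
  - have := cover_outer_ge0 (A n).
    by rewrite /cover_outer -/(Cov (A n)) Soo.
pose g (x : nat * nat) := oapp w 0 (G x.1 x.2).
have g_ge0 x : 0 <= g x by exact: (wF_ge0 _ (PG x.1).1).
apply: (@le_trans _ _ (\esum_(i in setT) g i)).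
  apply: ereal_inf_lbound => /=.
  have /card_esym/ppcard_eqP[f] := card_nat2.
  exists (fun k => G (f k).1 (f k).2).
    split => [k i|t [n _ Ant]]; first exact: (PG (f k).1).1.1.
    have [k _ Gt] := (PG n).1.2 _ Ant.
    by exists (f^-1%FUN (n, k)) => //=; rewrite invK ?inE.
  rewrite -[LHS]/(\sum_(k <oo) (g \o f) k).
  rewrite -(esum_pred_image g _ xpredT) ?[fun=> _]set_true//.
  by rewrite image_eq.
rewrite (_ : esum _ _ = \sum_(i <oo) \sum_(j <oo ) g (i, j)); last first.
  pose J : nat -> set (nat * nat) := fun i => [set (i, j) | j in setT].
  rewrite (_ : setT = \bigcup_k J k); last first.
    by rewrite predeqE => -[a b]; split => // _; exists a => //; exists b.
  rewrite esum_bigcupT /=; last 2 first.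
    - apply/trivIsetP => i j _ _ ij.
      rewrite predeqE => -[n m] /=; split => //= -[] [_] _ [<-{n} _].
      by move=> [m' _] [] /esym/eqP; rewrite (negbTE ij).
    - by move=> x; exact: g_ge0.
  rewrite -(image_id [set: nat]) -fun_true esum_pred_image//; last first.
    by move=> n _; apply: esum_ge0 => x _; exact: g_ge0.
  apply: eq_eseriesr => /= j _.
  rewrite -(esum_pred_image g (pair j) predT)//=; last first.
    by move=> ? ? _ _; exact: (@can_inj _ _ _ snd).
  by congr esum; rewrite predeqE => -[a b]; split; move=> [i _ <-]; exists i.
apply: lee_nneseries => [n _ _|n _]; first exact: nneseries_ge0.
exact: (PG n).2.
Qed.

End CoverOuter.

Definition box (R : realType) (n : nat) (ab : 'rV[R]_n * 'rV[R]_n) :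
    set 'rV[R]_n :=
  [set x | forall i, ab.1 0 i <= x 0 i <= ab.2 0 i].

Definition lebesgue_outer (R : realType) (n : nat) :
    set 'rV[R]_n -> \bar R :=
  cover_outer [set ab : 'rV[R]_n * 'rV[R]_n | forall i, ab.1 0 i <= ab.2 0 i]
    (@box R n) (fun ab => (\prod_(i < n) (ab.2 0 i - ab.1 0 i))%:E).

Lemma box_volume_ge0 (R : realType) (n : nat) (ab : 'rV[R]_n * 'rV[R]_n) :
  (forall i, ab.1 0 i <= ab.2 0 i) ->
  (0 <= (\prod_(i < n) (ab.2 0 i - ab.1 0 i))%:E)%E.
Proof. by move=> h; rewrite lee_fin prodr_ge0// => i _; rewrite subr_ge0. Qed.

HB.instance Definition _ (R : realType) (n : nat) :=
  isOuterMeasure.Build R 'rV[R]_n (@lebesgue_outer R n)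
    (@cover_outer0 _ _ _ _ _ _ (@box_volume_ge0 R n))
    (@cover_outer_ge0 _ _ _ _ _ _ (@box_volume_ge0 R n))
    (@le_cover_outer _ _ _ _ _ _)
    (@cover_outer_sigma_subadditive _ _ _ _ _ _ (@box_volume_ge0 R n)).

Definition volume (R : realType) (n : nat) :
    {measure set (caratheodory_type (@lebesgue_outer R n)) -> \bar R} :=
  caratheodory_measure (@lebesgue_outer R n).

(* pi^(s/2) / Gamma(s/2 + 1); with this normalization of the weights, the
   (n-1)-dimensional Hausdorff measure of R^n is the surface area. *)
Fixpoint unit_ball_volume (R : realType) (s : nat) : R :=
  match s with
  | 0 => 1
  | 1 => 2
  | s'.+2 => 2 * pi / s'.+2%:R * unit_ball_volume R s'
  end.

Definition ediam (R : realType) (n : nat) (A : set 'rV[R]_n) : \bar R :=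
  ereal_sup [set (enorm (x - y))%:E | x in A & y in A].

Definition hausdorff_weight (R : realType) (n s : nat) (A : set 'rV[R]_n) :
    \bar R :=
  (unit_ball_volume R s * (fine (ediam A) / 2) ^+ s)%:E.

Definition hausdorff_pre (R : realType) (n s : nat) (delta : R) :
    set 'rV[R]_n -> \bar R :=
  cover_outer [set A | A !=set0 /\ (ediam A <= delta%:E)%E] id
    (@hausdorff_weight R n s).

Definition hausdorff_outer (R : realType) (n s : nat) (A : set 'rV[R]_n) :
    \bar R :=
  ereal_sup [set hausdorff_pre s delta A | delta in [set d : R | 0 < d]].

Lemma unit_ball_volume_ge0 (R : realType) (s : nat) :
  0 <= unit_ball_volume R s.
Proof.
suff : 0 <= unit_ball_volume R s /\ 0 <= unit_ball_volume R s.+1 by case.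
elim: s => [|s [h0 h1]]; first by split; rewrite /= ?ler01 ?ler0n.
split=> //=; rewrite mulr_ge0// mulr_ge0 ?invr_ge0 ?ler0n//.
by rewrite mulr_ge0 ?ler0n ?pi_ge0.
Qed.

Lemma hausdorff_weight_ge0 (R : realType) (n s : nat) (delta : R)
    (A : set 'rV[R]_n) :
  A !=set0 /\ (ediam A <= delta%:E)%E -> (0 <= hausdorff_weight s A)%E.
Proof.
case=> -[x Ax] _; rewrite lee_fin mulr_ge0 ?unit_ball_volume_ge0//.
rewrite exprn_ge0// divr_ge0// fine_ge0//.
apply: (@le_trans _ _ (enorm (x - x))%:E); first by rewrite lee_fin sqrtr_ge0.
by apply: ereal_sup_ubound; exists x => //; exists x.
Qed.

Lemma hausdorff_outer_ge0 (R : realType) (n s : nat) (A : set 'rV[R]_n) :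
  (0 <= hausdorff_outer s A)%E.
Proof.
apply: (@le_trans _ _ (hausdorff_pre s 1 A)).
  exact/cover_outer_ge0/hausdorff_weight_ge0.
by apply: ereal_sup_ubound; exists 1 => //=; rewrite ltr01.
Qed.

Lemma hausdorff_outer0 (R : realType) (n s : nat) :
  hausdorff_outer s (set0 : set 'rV[R]_n) = 0%E.
Proof.
apply/eqP; rewrite eq_le hausdorff_outer_ge0 andbT.
apply: ge_ereal_sup => _ [d _ <-].
by rewrite /hausdorff_pre cover_outer0//; exact: hausdorff_weight_ge0.
Qed.

Lemma le_hausdorff_outer (R : realType) (n s : nat) :
  {homo @hausdorff_outer R n s : A B / A `<=` B >-> (A <= B)%E}.
Proof.
move=> A B AB; apply: ge_ereal_sup => _ [d d0 <-].
apply: (@le_trans _ _ (hausdorff_pre s d B)); first exact: le_cover_outer.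
by apply: ereal_sup_ubound; exists d.
Qed.

Lemma hausdorff_outer_sigma_subadditive (R : realType) (n s : nat) :
  sigma_subadditive (@hausdorff_outer R n s).
Proof.
move=> F; apply: ge_ereal_sup => _ [d d0 <-].
apply: le_trans (cover_outer_sigma_subadditive _ _) _.
  exact: hausdorff_weight_ge0.
apply: lee_nneseries => [k _ _|k _].
  exact/cover_outer_ge0/hausdorff_weight_ge0.
by apply: ereal_sup_ubound; exists d.
Qed.

HB.instance Definition _ (R : realType) (n s : nat) :=
  isOuterMeasure.Build R 'rV[R]_n (@hausdorff_outer R n s)
    (@hausdorff_outer0 R n s) (@hausdorff_outer_ge0 R n s)
    (@le_hausdorff_outer R n s) (@hausdorff_outer_sigma_subadditive R n s).

Definition hausdorff_measure (R : realType) (n s : nat) :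
    {measure set (caratheodory_type (@hausdorff_outer R n s)) -> \bar R} :=
  caratheodory_measure (@hausdorff_outer R n s).

Definition convex_body (R : realType) (n : nat) (K : set 'rV[R]_n) : Prop :=
  [/\ compact K, convex_set (K : set (convex_lmodType 'rV[R]_n)) & K° !=set0].

Definition boundary (R : realType) (n : nat) (K : set 'rV[R]_n) :
    set 'rV[R]_n :=
  closure K `\` K°.

Definition centroid (R : realType) (n : nat) (K : set 'rV[R]_n) : 'rV[R]_n :=
  \row_(i < n) ((\int[volume R n]_(x in K) x 0 i) / fine (volume R n K))%R.

Definition C1_on (R : realType) (n : nat) (U : set 'rV[R]_n)
    (g : 'rV[R]_n -> R) : Prop :=
  forall x, U x -> differentiable g x /\ forall v, {for x, continuous ('D_v g)}.

Definition C2_on (R : realType) (n : nat) (U : set 'rV[R]_n)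
    (g : 'rV[R]_n -> R) : Prop :=
  C1_on U g /\ forall v, C1_on U ('D_v g).

(* The boundary of K is an embedded C^2 hypersurface: around each of its points
   it is the zero set of a C^2 function with nonvanishing differential. *)
Definition C2_boundary (R : realType) (n : nat) (K : set 'rV[R]_n) : Prop :=
  forall x, boundary K x ->
    exists (U : set 'rV[R]_n) (g : 'rV[R]_n -> R),
      [/\ open_nbhs x U, C2_on U g, (exists v, 'D_v g x != 0) &
          boundary K `&` U = [set y | U y /\ g y = 0]].

(* N(x), the outer unit normal of K at the boundary point x; it is unique when
   the boundary is C^1. *)
Definition outer_normal (R : realType) (n : nat) (K : set 'rV[R]_n)
    (x : 'rV[R]_n) : 'rV[R]_n :=
  xget 0 [set u | enorm u = 1 /\ forall y, K y -> dot (y - x) u <= 0].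

(* The matrix A, acting on row vectors from the right, restricts on the tangent
   space at x to the Weingarten map, i.e. the differential of N along the
   boundary, and is extended by 0 on the normal line. *)
Definition is_weingarten (R : realType) (n : nat) (K : set 'rV[R]_n)
    (x : 'rV[R]_n) (A : 'M[R]_n) : Prop :=
  outer_normal K x *m A = 0 /\
  forall e : R, 0 < e -> \forall y \near within (boundary K) (nbhs x),
    `|outer_normal K y - outer_normal K x - (y - x) *m A| <= e * `|y - x|.

(* k_1(x), ..., k_(n-1)(x), listed in some order: the eigenvalues of the
   Weingarten map.  The factor 'X accounts for the normal line. *)
Definition principal_curvatures (R : realType) (n : nat) (K : set 'rV[R]_n)
    (x : 'rV[R]_n) : 'rV[R]_n.-1 :=
  xget 0 [set kappa : 'rV[R]_n.-1 | exists A : 'M[R]_n,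
    is_weingarten K x A /\
    char_poly A = 'X * \prod_(l < n.-1) ('X - (kappa 0 l)%:P)].

Definition mean_curvature (R : realType) (n : nat) (K : set 'rV[R]_n) (j : nat)
    (x : 'rV[R]_n) : R :=
  'C(n.-1, j)%:R^-1 *
  \sum_(J : {set 'I_n.-1} | #|J| == j)
    \prod_(l in J) principal_curvatures K x 0 l.

Definition gauss_curvature (R : realType) (n : nat) (K : set 'rV[R]_n)
    (x : 'rV[R]_n) : R :=
  \prod_(l < n.-1) principal_curvatures K x 0 l.

Definition C2_plus (R : realType) (n : nat) (K : set 'rV[R]_n) : Prop :=
  [/\ convex_body K, C2_boundary K &
      forall x, boundary K x -> 0 < gauss_curvature K x].

Definition C2_plus_centered (R : realType) (n : nat) (K : set 'rV[R]_n) :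
    Prop :=
  C2_plus K /\ centroid K = 0.

(* When the centroid of a convex body is the origin, the origin is an interior
   point, so both bases of the real powers (powR) are positive for the K in
   C2_plus_centered. *)
Definition affine_surface_area (R : realType) (n : nat) (p : R) (m k : nat)
    (i : 'I_n -> nat) (K : set 'rV[R]_n) : \bar R :=
  (\int[hausdorff_measure R n n.-1]_(x in boundary K)
    (mean_curvature K n.-1 x `^ (p / (n%:R + p))
     / dot x (outer_normal K x) `^ (n%:R * (p - 1) / (n%:R + p))
     * dot x (outer_normal K x) ^ (m%:Z - k%:Z)
     * \prod_(j < n | (1 <= j)%N)
         ('C(n.-1, j)%:R ^+ i j * mean_curvature K j x ^+ i j))%:E)%E.

(* Main.v *)
Require Import Defs.
From HB Require Import structures.
From mathcomp Require Import all_boot all_order all_algebra.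
From mathcomp Require Import all_classical all_reals all_analysis.
From mathcomp Require Import measurable_realfun ring lra zify.
Set Implicit Arguments.
Unset Strict Implicit.
Unset Printing Implicit Defensive.
Import Order.TTheory GRing.Theory Num.Theory.
Import numFieldNormedType.Exports.
Local Open Scope classical_set_scope.
Local Open Scope ring_scope.

(** Writing f for the integrand of the functional, each of the three claims
    reduces to a pointwise statement on f together with elementary measure
    theory of the boundary.

    What the integrand is.  At a boundary point x the gradient of a local
    defining function g gives the unique outer unit normal N(x), up to a sign
    that is fixed by an interior point ([chart_normalP]), and the Weingarten map
    is P (l H) P, where P is the projection along N(x), H the Hessian of g and l
    the signed inverse length of the gradient ([chart_weingarten]).  Both facts
    are read off along directions in which the boundary can be approached: by
    the intermediate value theorem every tangent vector is such a direction
    ([level_set_contingent]).  Hence the Weingarten map is unique and depends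
    continuously on x ([weingarten_cvg]).  The mean curvatures are, up to
    constants, coefficients of its characteristic polynomial
    ([mean_curvature_coef]), so they are continuous; they are nonnegative
    because the normals of a convex body are monotone ([weingarten_ge0]).
    Together with the nonnegativity of the support function this makes f
    measurable and nonnegative, so that its integral is additive over measurable
    pieces of the boundary without any integrability assumption.

    Where the centroid is used.  The support function is nonnegative as soon as
    the origin belongs to the body.  If it did not, the point z of the body
    nearest to the origin would satisfy z.z <= y.z for all y in the body, and
    integrating over the body, whose volume is positive and finite, would
    contradict that the coordinates have integral zero ([centroid0_mem]).  The
    positivity of the volume is the inequality between the volume of a box and
    the total volume of the boxes covering it, proved by slicing
    ([prod_length_le_cover]).

    Homogeneity and invariance.  Both are the behaviour under a similarity
    T x = a (x Q) with Q orthogonal.  The Hausdorff measure of dimension n - 1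
    is multiplied by a^(n-1) ([integral_similarity]), normals are rotated, the
    Weingarten map is conjugated by Q and divided by a, and the powers of a
    add up to the announced degree ([affine_density_similarity]).

    Valuation.  The boundaries of K, L, their union and their intersection are
    cut into the points of one boundary that are outside or inside the other
    body, where locally only one body is seen ([local_affine_density]), and the
    contact set, where both boundaries meet.  On the contact set the four
    normals agree, and every tangent direction of one of the four boundaries is
    approached within one of two others; since a vector space is not the union
    of two proper subspaces, its Weingarten map is one of theirs
    ([weingarten_contact]).  So the Weingarten maps of the union and of the
    intersection are those of K and L, in some order, and the sums of the
    integrands agree ([affine_density_contact]). *)

(** * The Euclidean inner product *)

Section DotProduct.
Context {R : realType} {n : nat}.
Implicit Types (u v w x y : 'rV[R]_n) (a : R).

Lemma dotE u v : dot u v = (u *m v^T) 0 0.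
Proof. by rewrite mxE; apply: eq_bigr => i _; rewrite mxE. Qed.

Lemma dotC u v : dot u v = dot v u.
Proof. by apply: eq_bigr => i _; rewrite mulrC. Qed.

Lemma dotDl u v w : dot (u + v) w = dot u w + dot v w.
Proof. by rewrite !dotE mulmxDl mxE. Qed.

Lemma dotZl a u v : dot (a *: u) v = a * dot u v.
Proof. by rewrite !dotE -scalemxAl mxE. Qed.

Lemma dotNl u v : dot (- u) v = - dot u v.
Proof. by rewrite -scaleN1r dotZl mulN1r. Qed.

Lemma dotBl u v w : dot (u - v) w = dot u w - dot v w.
Proof. by rewrite dotDl dotNl. Qed.

Lemma dotDr u v w : dot w (u + v) = dot w u + dot w v.
Proof. by rewrite !(dotC w) dotDl. Qed.

Lemma dotZr a u v : dot u (a *: v) = a * dot u v.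
Proof. by rewrite !(dotC u) dotZl. Qed.

Lemma dotBr u v w : dot w (u - v) = dot w u - dot w v.
Proof. by rewrite !(dotC w) dotBl. Qed.

Lemma dot0l u : dot 0 u = 0.
Proof. by rewrite dotE mul0mx mxE. Qed.

Lemma dot0r u : dot u 0 = 0.
Proof. by rewrite dotC dot0l. Qed.

Lemma dot_mulmxl u v (A : 'M[R]_n) : dot (u *m A) v = dot u (v *m A^T).
Proof. by rewrite !dotE trmx_mul trmxK mulmxA. Qed.

Lemma dot_ge0 u : 0 <= dot u u.
Proof. by apply: sumr_ge0 => i _; rewrite -expr2 sqr_ge0. Qed.

Lemma dot_eq0 u : dot u u = 0 -> u = 0.
Proof.
move=> /eqP; rewrite psumr_eq0 => [/allP uu|i _]; last by rewrite -expr2 sqr_ge0.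
apply/rowP => i; rewrite mxE; apply/eqP.
by have := uu i (mem_index_enum _); rewrite /= -expr2 sqrf_eq0.
Qed.

Lemma dot_gt0 u : u != 0 -> 0 < dot u u.
Proof.
by move=> u0; rewrite lt_def dot_ge0 andbT; apply: contra_neq u0; exact: dot_eq0.
Qed.

Lemma sqr_enorm u : enorm u ^+ 2 = dot u u.
Proof. by rewrite sqr_sqrtr ?dot_ge0. Qed.

Lemma enormZ a u : enorm (a *: u) = `|a| * enorm u.
Proof. by rewrite /enorm dotZl dotZr mulrA -expr2 sqrtrM ?sqr_ge0// sqrtr_sqr. Qed.

Lemma enorm_eq1 u : enorm u = 1 -> dot u u = 1.
Proof. by rewrite -sqr_enorm => ->; rewrite expr1n. Qed.

Lemma ler_coord_enorm u i : `|u 0 i| <= enorm u.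
Proof.
rewrite -sqrtr_sqr ler_sqrt ?dot_ge0// /dot (bigD1 i)//= expr2 lerDl.
by apply: sumr_ge0 => j _; rewrite -expr2 sqr_ge0.
Qed.

Lemma ler_coord_norm u i : `|u 0 i| <= `|u|.
Proof.
rewrite /Num.norm/= mx_normrE.
by apply: (le_bigmax _ (fun k => `|u k.1 k.2|) (0, i)).
Qed.

Lemma norm_rV_le u a : 0 <= a -> (forall i, `|u 0 i| <= a) -> `|u| <= a.
Proof.
move=> a0 ua; rewrite /Num.norm/= mx_normrE; apply: bigmax_le => // -[j i] _ /=.
by rewrite (ord1 j).
Qed.

Lemma norm_dot_le u v : `|dot u v| <= n%:R * `|u| * `|v|.
Proof.
apply: (le_trans (ler_norm_sum _ _ _)).
apply: (@le_trans _ _ (\sum_(i < n) `|u| * `|v|)).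
  by apply: ler_sum => i _; rewrite normrM ler_pM// ler_coord_norm.
by rewrite sumr_const card_ord -mulrA mulr_natl.
Qed.

End DotProduct.

(** * Measurability of open sets for outer measures on row vectors *)

(** The classical argument for metric outer measures, with the level function in
    place of a distance.  The part of X above level c is approximated from
    inside by the parts above c + 1/(k+1); what is left is a union of annuli,
    every second of which are separated, so their masses are summable when X has
    finite mass, and the tail of the sum goes to zero. *)
Lemma caratheodory_sublevel {R : realType} {T : Type}
    (mu : {outer_measure set T -> \bar R}) (phi : T -> R) (c : R) :
  (forall (s t : R) (A B : set T), s < t ->
     (forall x, A x -> phi x <= s) -> (forall x, B x -> t < phi x) ->
     (mu A + mu B <= mu (A `|` B))%E) ->
  mu.-caratheodory [set x | phi x <= c].
Proof.
move=> sep; apply: le_caratheodory_measurable => X.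
have [->|muX] := eqVneq (mu X) +oo%E; first by rewrite leey.
have muXfin : mu X \is a fin_num.
  by rewrite ge0_fin_numE ?outer_measure_ge0// lt_neqAle muX leey.
pose S := [set x | phi x <= c].
pose t (k : nat) : R := c + k.+1%:R^-1.
have t_gt k : c < t k by rewrite /t ltrDl invr_gt0.
have t_lt k : t k.+1 < t k by rewrite /t ltrD2l ltf_pV2 ?posrE// ltr_nat.
have t_le j k : (j <= k)%N -> t k <= t j.
  by move=> jk; rewrite /t lerD2l lef_pV2 ?posrE// ler_nat.
pose U k := X `&` [set x | t k < phi x].
pose D k := X `&` [set x | t k.+1 < phi x <= t k].
have muU k : (mu (U k) <= mu X)%E by apply: le_outer_measure => x [].
(* the strip between the levels t k.+1 and t k separates the annulus from U k *)
have annulus k : (mu (D k.+1) + mu (U k) <= mu (U k.+2))%E.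
  apply: (@le_trans _ _ (mu (D k.+1 `|` U k))).
    apply: (sep (t k.+1) (t k)) => // x [_] //=.
    by move=> /andP[].
  apply: le_outer_measure => x [[Xx /andP[tx _]]|[Xx tx]]; split => //=.
  by apply: lt_trans tx; apply: lt_trans (t_lt _).
have sumD m : (\sum_(0 <= k < m) mu (D k.+1) <= mu X + mu X)%E.
  apply: (@le_trans _ _ (mu (U m) + mu (U m.+1))%E); last exact: leeD.
  elim: m => [|m ih]; first by rewrite big_nil adde_ge0//; exact: outer_measure_ge0.
  rewrite big_nat_recr//= addeC.
  apply: (le_trans (leeD2l _ ih)).
  by rewrite addeA addeC leeD2l.
have serD : (\sum_(0 <= k <oo) mu (D k.+1) < +oo)%E.
  apply: (@le_lt_trans _ _ (mu X + mu X)%E); last first.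
    by rewrite ltey_eq fin_numD muXfin.
  apply: lime_le; first by apply: is_cvg_nneseries => *; exact: outer_measure_ge0.
  by apply: nearW => m; exact: sumD.
have tail := nneseries_tail_cvg serD (fun k _ => outer_measure_ge0 mu _).
have bound N : (mu (X `&` S) + mu (X `&` ~` S) <=
    mu X + \sum_(N <= k <oo) mu (D k.+1))%E.
  apply: (@le_trans _ _ (mu (X `&` S) +
      (mu (U N.+1) + \sum_(N <= k <oo) mu (D k.+1)))%E).
    apply: leeD2l.
    rewrite -(@nneseries_addn _ (fun k => mu (D k.+1))); last first.
      by move=> k; exact: outer_measure_ge0.
    apply: le_trans (leeD2l _ (outer_measure_sigma_subadditive mu _)).
    apply: le_trans (outer_measureU2 _ _ _).
    apply: le_outer_measure => x [Xx /negP]; rewrite -ltNge => cx.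
    have [k kx] : exists k, t k < phi x.
      have /ltr_add_invr[k] := cx; by exists k.
    have [Ux|Ux] := ltP (t N.+1) (phi x); first by left.
    right; have ex : exists k, t k < phi x by exists k.
    case: (ex_minnP ex) => -[|j] tj jmin.
      by have := lt_le_trans (lt_le_trans tj Ux) (t_le _ _ (leq0n N.+1));
        rewrite ltxx.
    have xj : phi x <= t j.
      by rewrite leNgt; apply/negP => /jmin; rewrite ltnn.
    have Nj : (N.+1 <= j)%N.
      rewrite leqNgt; apply/negP => jN.
      by have := lt_le_trans tj (le_trans Ux (t_le _ _ jN)); rewrite ltxx.
    exists (j.-1 - N)%N => //; split => //=.
    by rewrite subnK ?prednK ?tj ?xj//; lia.
  rewrite addeA leeD2r//.
  apply: le_trans (sep c (t N.+1) _ _ _ _ _) _ => //.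
  - by move=> x [].
  - by move=> x [].
  - by apply: le_outer_measure => x [[]|[]].
apply/lee_addgt0Pr => e e0.
have [N _ /(_ N (leqnn N)) te] : \forall N \near \oo,
    (\sum_(N <= k <oo) mu (D k.+1) < e%:E)%E.
  by have := @open_ereal_lt' _ 0%E e%:E; rewrite lte_fin => /(_ e0)/tail.
by apply: le_trans (bound N) _; rewrite leeD2l// ltW.
Qed.

(** Every open set is a countable union of half-open boxes with rational
    vertices, which are finite intersections of half-spaces and complements of
    half-spaces. *)
Lemma open_caratheodory {R : realType} {n : nat}
    (mu : {outer_measure set 'rV[R]_n -> \bar R}) (U : set 'rV[R]_n) :
  (forall i c, mu.-caratheodory [set x : 'rV[R]_n | x 0 i <= c]) ->
  open U -> mu.-caratheodory U.
Proof.
move=> half oU.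
pose hbox (q : 'rV[rat]_n * 'rV[rat]_n) : set 'rV[R]_n :=
  [set x | forall i, ratr (q.1 0 i) < x 0 i <= ratr (q.2 0 i)].
have mhbox q : mu.-caratheodory (hbox q).
  have -> : hbox q = \bigcap_(i in [set: 'I_n])
      (~` [set x | x 0 i <= ratr (q.1 0 i)] `&` [set x | x 0 i <= ratr (q.2 0 i)]).
    apply/seteqP; split => x /= hx i; last first.
      by have [/= /negP + xb] := hx i I; rewrite -ltNge xb andbT.
    by move=> _; have /andP[xa xb] := hx i; split => //=; apply/negP; rewrite -ltNge.
  apply: (@fin_bigcap_measurable _ (caratheodory_type mu) _ _ (fun i =>
    ~` [set x : 'rV[R]_n | x 0 i <= ratr (q.1 0 i)] `&` [set x | x 0 i <= ratr (q.2 0 i)]))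
    => // i _.
  apply: caratheodory_measurable_setI; last exact: half.
  by apply: caratheodory_measurable_setC; exact: half.
have -> : U = \bigcup_q (if `[< hbox q `<=` U >] then hbox q else set0).
  apply/seteqP; split => x; last first.
    by move=> [q _]; case: asboolP => // + qx; exact.
  move=> Ux; have /nbhs_ballP[e /= e0 eU] := oU x Ux.
  have rl i : exists q : rat, x 0 i - e < ratr q < x 0 i.
    by have [|q /itvP qe] := @rat_in_itvoo R (x 0 i - e) (x 0 i);
      [rewrite ltrBlDr ltrDl|exists q; rewrite !qe].
  have rr i : exists q : rat, x 0 i < ratr q < x 0 i + e.
    by have [|q /itvP qe] := @rat_in_itvoo R (x 0 i) (x 0 i + e);
      [rewrite ltrDl|exists q; rewrite !qe].
  have [a ha] := choice rl; have [b hb] := choice rr.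
  exists (\row_i a i, \row_i b i) => //.
  rewrite asboolT => [i|y hy].
    by rewrite !mxE; have /andP[_ ->] := ha i; have /andP[/ltW -> _] := hb i.
  apply: eU; split => // j i; rewrite (ord1 j) /ball/= ltr_norml.
  have := hy i; rewrite /= !mxE => /andP[ya yb].
  have /andP[xa _] := ha i; have /andP[_ xb] := hb i.
  by apply/andP; split; lra.
apply: (@countable_bigcupT_measurable _ (caratheodory_type mu)) => // q.
by case: ifP => _; [exact: mhbox|exact: caratheodory_measurable_set0].
Qed.

(** * Open sets are measurable for Hausdorff measures *)

Section HausdorffMeasurability.
Context {R : realType} {n : nat}.
Implicit Types (A B : set 'rV[R]_n) (s : nat).

Lemma enorm_le_ediam A x y : A x -> A y -> ((enorm (x - y))%:E <= ediam A)%E.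
Proof. by move=> Ax Ay; apply: ereal_sup_ubound; exists x => //; exists y. Qed.

Lemma hausdorff_pre_ge0 s d A : (0 <= hausdorff_pre s d A)%E.
Proof. exact/cover_outer_ge0/hausdorff_weight_ge0. Qed.

Lemma le_hausdorff_pre s d d' A : d <= d' ->
  (hausdorff_pre s d' A <= hausdorff_pre s d A)%E.
Proof.
move=> dd'; apply: ereal_inf_le_tmp => _ [F [DF AF] <-].
exists F => //; split => // k B /DF[B0 dB]; split => //.
by apply: le_trans dB _; rewrite lee_fin.
Qed.

(** A set of diameter at most d < e cannot meet both A and B, so a cover of the
    union splits into a cover of A and a cover of B. *)
Lemma hausdorff_pre_separated s (d e : R) A B : d < e ->
  (forall x y, A x -> B y -> e <= enorm (x - y)) ->
  (hausdorff_pre s d A + hausdorff_pre s d B <= hausdorff_pre s d (A `|` B))%E.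
Proof.
move=> de AB; apply: le_ereal_inf_tmp => _ [F [DF covF] <-].
pose w := @hausdorff_weight R n s.
pose FA A k := if F k is Some Y then
  if `[< Y `&` A !=set0 >] then Some Y else None else None.
have FAD C k Y : FA C k = Some Y -> F k = Some Y.
  by rewrite /FA; case: (F k) => // Y'; case: asboolP.
have w_ge0 C k : (0 <= oapp w 0 (FA C k))%E.
  case E : (FA C k) => [Y|]//=.
  by apply: (@hausdorff_weight_ge0 _ _ _ d); apply: (DF k); exact: FAD E.
have preC C : C `<=` A `|` B ->
    (hausdorff_pre s d C <= \sum_(k <oo) oapp w 0 (FA C k))%E.
  move=> CAB; apply: ereal_inf_lbound; exists (FA C) => //; split.
    by move=> k Y /FAD/DF.
  move=> x Cx; have [k _ Fx] := covF x (CAB _ Cx); exists k => //.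
  move: Fx; rewrite /FA; case: (F k) => //= Y Sx.
  by rewrite asboolT//; exists x.
apply: le_trans (leeD (preC A _) (preC B _)) _; [by left|by right|].
rewrite -nneseriesD//; apply: lee_nneseries => [k _ _|k _].
  by apply: adde_ge0.
have := DF k; rewrite /FA; case: (F k) => [Y|]/=; last by rewrite adde0.
move=> /(_ Y erefl) DS; have wS : (0 <= w Y)%E := hausdorff_weight_ge0 s DS.
case: asboolP => [[x [Sx Ax]]|_]; case: asboolP => [[y [Sy By]]|_]//=.
- have := le_trans (enorm_le_ediam Sx Sy) DS.2.
  by rewrite lee_fin => /(le_trans (AB _ _ Ax By)); rewrite leNgt de.
- by rewrite adde0.
- by rewrite add0e.
- by rewrite adde0.
Qed.

(** The measure is a supremum over the scale d; the scales chosen for A and B can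
    be replaced by a common smaller one. *)
Lemma hausdorff_separated s (e : R) A B : 0 < e ->
  (forall x y, A x -> B y -> e <= enorm (x - y)) ->
  (hausdorff_outer s A + hausdorff_outer s B <= hausdorff_outer s (A `|` B))%E.
Proof.
move=> e0 AB.
have hA d : 0 < d -> (hausdorff_pre s d A + hausdorff_outer s B <=
    hausdorff_outer s (A `|` B))%E.
  move=> d0; have [preA|] := eqVneq (hausdorff_pre s d A) +oo%E.
    suff -> : hausdorff_outer s (A `|` B) = +oo%E by rewrite leey.
    apply/eqP; rewrite -leye_eq -preA.
    apply: (@le_trans _ _ (hausdorff_pre s d (A `|` B))).
      by apply: le_cover_outer; left.
    by apply: ereal_sup_ubound; exists d.
  move=> preA; have preAfin : hausdorff_pre s d A \is a fin_num.
    by rewrite ge0_fin_numE ?hausdorff_pre_ge0// lt_neqAle preA leey.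
  rewrite addeC -leeBrDr//; apply: ge_ereal_sup => _ [d' d'0 <-].
  rewrite leeBrDr// addeC.
  (* the scale must stay strictly below the gap e *)
  pose m := Num.min (Num.min d d') (e / 2).
  have m0 : 0 < m by rewrite !lt_min d0 d'0 divr_gt0.
  have [md md'] : m <= d /\ m <= d'.
    by rewrite /m !ge_min !lexx /= !orbT.
  apply: (@le_trans _ _ (hausdorff_pre s m A + hausdorff_pre s m B)%E).
    by apply: leeD; exact: le_hausdorff_pre.
  apply: (@le_trans _ _ (hausdorff_pre s m (A `|` B))).
    apply: hausdorff_pre_separated AB.
    by apply: (@le_lt_trans _ _ (e / 2)); [rewrite ge_min lexx orbT|lra].
  by apply: ereal_sup_ubound; exists m.
have [HB|] := eqVneq (hausdorff_outer s B) +oo%E.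
  by move: (hA 1 ltr01); rewrite HB addeC addye ?leye_eq => [/eqP ->|];
    [rewrite leey|rewrite gt_eqF// (lt_le_trans _ (hausdorff_pre_ge0 _ _ _))].
move=> HB; have HBfin : hausdorff_outer s B \is a fin_num.
  by rewrite ge0_fin_numE ?hausdorff_outer_ge0// lt_neqAle HB leey.
rewrite -leeBrDr//; apply: ge_ereal_sup => _ [d d0 <-].
by rewrite leeBrDr//; exact: hA.
Qed.

(** Coordinates do not increase Euclidean distances, so parts of space at distinct
    levels of a coordinate are separated. *)
Lemma open_hausdorff_measurable s (U : set 'rV[R]_n) :
  open U -> (@hausdorff_outer R n s).-caratheodory U.
Proof.
apply: open_caratheodory => i c.
apply: (@caratheodory_sublevel _ _ _ (fun x : 'rV[R]_n => x 0 i)) => a b A B ab Aa Bb.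
apply: (@hausdorff_separated s (b - a)); first by rewrite subr_gt0.
move=> x y Ax By; apply: le_trans (ler_coord_enorm _ i).
rewrite !mxE distrC; apply: le_trans (ler_norm _).
have := Aa x Ax; have := Bb y By; lra.
Qed.

End HausdorffMeasurability.

(** * Hausdorff measures under similarities *)

Section Similarity.
Context {R : realType} {n : nat} (a : R) (T : 'rV[R]_n -> 'rV[R]_n).
Hypotheses (a_gt0 : 0 < a)
  (simT : forall x y, enorm (T x - T y) = a * enorm (x - y)).
Implicit Types A : set 'rV[R]_n.

Lemma ediam_similarity A : ediam (T @` A) = (a%:E * ediam A)%E.
Proof.
rewrite /ediam -ereal_sup_pZl//; congr ereal_sup; apply/seteqP; split => z.
  move=> [_ [x Ax <-]] [_ [y Ay <-]] <-; exists (enorm (x - y))%:E.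
    by exists x => //; exists y.
  by rewrite simT EFinM.
move=> [_ [x Ax] [y Ay <-] <-]; exists (T x); first by exists x.
by exists (T y); [exists y|rewrite simT EFinM].
Qed.

Lemma hausdorff_weight_similarity s A :
  hausdorff_weight s (T @` A) = ((a ^+ s)%:E * hausdorff_weight s A)%E.
Proof.
rewrite /hausdorff_weight -EFinM ediam_similarity; congr EFin.
suff -> : fine (a%:E * ediam A) = a * fine (ediam A).
  by rewrite -mulrA exprMn mulrCA.
case: (ediam A) => [r||] //=; first by rewrite mulr0 gt0_muley.
by rewrite mulr0 gt0_muleNy.
Qed.

Lemma le_hausdorff_similarity s A :
  (hausdorff_outer s (T @` A) <= (a ^+ s)%:E * hausdorff_outer s A)%E.
Proof.
have as0 : 0 < a ^+ s by rewrite exprn_gt0.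
apply: ge_ereal_sup => _ [d d0 <-].
apply: (@le_trans _ _ ((a ^+ s)%:E * hausdorff_pre s (d / a) A)%E); last first.
  rewrite lee_pmul2l ?lte_fin//; apply: ereal_sup_ubound; exists (d / a) => //=.
  by rewrite divr_gt0.
rewrite -lee_pdivrMl//; apply: le_ereal_inf_tmp => _ [F [DF AF] <-].
rewrite lee_pdivrMl// -nneseriesZl; last first.
  move=> k _; case E : (F k) => [Y|]//=.
  by apply: hausdorff_weight_ge0; exact: DF E.
apply: ereal_inf_lbound; exists (fun k => omap (image^~ T) (F k)).
  split.
    move=> k Y; case E : (F k) => [Z|]//= -[<-]; have [[z Zz] dZ] := DF _ _ E.
    split; first by exists (T z); exists z.
    rewrite ediam_similarity.
    apply: (@le_trans _ _ (a%:E * (d / a)%:E)%E).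
      by rewrite lee_pmul2l ?lte_fin.
    by rewrite -EFinM mulrC divfK// gt_eqF.
  move=> _ [x Ax <-]; have [k _ Fx] := AF x Ax; exists k => //.
  by case: (F k) Fx => //= Y Yx; exists x.
apply: eq_eseriesr => k _; case: (F k) => [Y|]/=; last by rewrite mule0.
exact: hausdorff_weight_similarity.
Qed.

End Similarity.

Section ChangeOfVariables.
Context {R : realType} {n : nat} (a : R) (T T' : 'rV[R]_n -> 'rV[R]_n).
Hypotheses (a_gt0 : 0 < a)
  (simT : forall x y, enorm (T x - T y) = a * enorm (x - y))
  (TK : cancel T T') (TK' : cancel T' T).

(** The missing inequality is the one for the inverse similarity. *)
Lemma hausdorff_similarity s (A : set 'rV[R]_n) :
  hausdorff_outer s (T @` A) = ((a ^+ s)%:E * hausdorff_outer s A)%E.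
Proof.
apply/eqP; rewrite eq_le le_hausdorff_similarity//=.
have simT' x y : enorm (T' x - T' y) = a^-1 * enorm (x - y).
  by rewrite -{2}(TK' x) -{2}(TK' y) simT mulKf// gt_eqF.
have av_gt0 : 0 < a^-1 by rewrite invr_gt0.
rewrite -lee_pdivlMl ?exprn_gt0// -exprVn.
have := le_hausdorff_similarity av_gt0 simT' s (T @` A).
by rewrite image_comp (_ : _ @` A = A)//; apply/seteqP; split => [_ [x Ax <-]|x Ax];
  [rewrite /= TK|exists x => //=; rewrite TK].
Qed.

Lemma hausdorff_similarity_preimage s (A : set 'rV[R]_n) :
  hausdorff_outer s (T @^-1` A) = ((a ^- s)%:E * hausdorff_outer s A)%E.
Proof.
have {2}-> : A = T @` (T @^-1` A).
  by apply/seteqP; split => [x Ax|_ [x Ax <-]//]; exists (T' x); rewrite /= TK'.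
by rewrite hausdorff_similarity muleA -EFinM mulVf ?mul1e// gt_eqF// exprn_gt0.
Qed.

Lemma measurable_similarity s :
  measurable_fun [set: caratheodory_type (@hausdorff_outer R n s)]
    (T : caratheodory_type (@hausdorff_outer R n s) ->
         caratheodory_type (@hausdorff_outer R n s)).
Proof.
move=> _ A mA; rewrite setTI.
suff : (@hausdorff_outer R n s).-caratheodory (T @^-1` A) by [].
move=> X.
have as0 : a ^+ s != 0 by rewrite gt_eqF// exprn_gt0.
have XE B : hausdorff_outer s (X `&` T @^-1` B) =
    ((a ^- s)%:E * hausdorff_outer s (T @` X `&` B))%E.
  rewrite -hausdorff_similarity_preimage; congr hausdorff_outer.
  apply/seteqP; split => x /= [Xx Bx]; split => //; first by exists x.
  by case: Xx => y Xy /(can_inj TK) <-.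
have := XE setT; rewrite preimage_setT !setIT => ->.
by rewrite preimage_setC !XE -ge0_muleDr ?hausdorff_outer_ge0// -(mA (T @` X)).
Qed.

End ChangeOfVariables.

(** The image of the Hausdorff measure under the inverse similarity is its multiple
    by a^s. *)
Lemma integral_similarity {R : realType} {n : nat} (a : R)
    (T T' : 'rV[R]_n -> 'rV[R]_n) s (D : set 'rV[R]_n)
    (f : 'rV[R]_n -> \bar R) :
  0 < a -> (forall x y, enorm (T x - T y) = a * enorm (x - y)) ->
  cancel T T' -> cancel T' T ->
  (@hausdorff_outer R n s).-caratheodory D ->
  measurable_fun (D : set (caratheodory_type (@hausdorff_outer R n s))) f ->
  (forall x, D x -> 0 <= f x)%E ->
  (\int[hausdorff_measure R n s]_(y in T @` D) f (T' y) =
   (a ^+ s)%:E * \int[hausdorff_measure R n s]_(x in D) f x)%E.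
Proof.
move=> a0 simT TK TK' mD mf f0.
have simT' x y : enorm (T' x - T' y) = a^-1 * enorm (x - y).
  by rewrite -{2}(TK' x) -{2}(TK' y) simT mulKf// gt_eqF.
have av_gt0 : 0 < a^-1 by rewrite invr_gt0.
have mT' := @measurable_similarity _ _ _ _ _ av_gt0 simT' TK' TK s.
have -> : T @` D = T' @^-1` D.
  apply/seteqP; split => [_ [x Dx <-]|y Dy]; first by rewrite /= TK.
  by exists (T' y).
have as0 : 0 <= a ^+ s by rewrite exprn_ge0// ltW.
rewrite -[LHS](ge0_integral_pushforward mT' _ mD mf); last first.
  by move=> y /[!inE]; exact: f0.
rewrite -(ge0_integral_mscale (hausdorff_measure R n s) mD (NngNum as0) mf)//.
apply: eq_measure_integral => A mA _.
rewrite /= /pushforward /mscale/=.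
have := hausdorff_similarity_preimage av_gt0 simT' TK' TK s A.
by rewrite exprVn invrK.
Qed.

(** * Volume of boxes *)

(** Induction on the dimension.  Over a point t of the last side, the boxes whose
    last side contains t still cover the slice, so the volume of the slice is at
    most the sum of their slice volumes; integrating over t and exchanging sum and
    integral gives the claim.  Points are functions on all of nat and only the
    first n coordinates matter, which makes slicing trivial. *)
Lemma prod_length_le_cover {R : realType} (n : nat) (a b : nat -> R)
    (P : nat -> bool) (lo hi : nat -> nat -> R) :
  (forall i, (i < n)%N -> a i <= b i) ->
  (forall k i, P k -> (i < n)%N -> lo k i <= hi k i) ->
  (forall x : nat -> R, (forall i, (i < n)%N -> a i <= x i <= b i) ->
     exists2 k, P k & forall i, (i < n)%N -> lo k i <= x i <= hi k i) ->
  ((\prod_(i < n) (b i - a i))%:E <=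
   \sum_(k <oo) (if P k then (\prod_(i < n) (hi k i - lo k i))%:E else 0))%E.
Proof.
elim: n a b P lo hi => [|n IH] a b P lo hi ab lohi cov.
  have [|k Pk _] := cov a => //; rewrite big_ord0.
  apply: le_trans (nneseries_lim_ge k.+1 _); last first.
    by move=> j _ _; case: ifP => // _; rewrite big_ord0.
  rewrite big_nat_recr//= Pk big_ord0 leeDr// sume_ge0// => j _.
  by case: ifP => // _; rewrite big_ord0.
pose c k := if P k then \prod_(i < n) (hi k i - lo k i) else 0.
have c_ge0 k : 0 <= c k.
  rewrite /c; case: ifP => // Pk; apply: prodr_ge0 => i _.
  by rewrite subr_ge0 lohi// ltnS ltnW.
pose I k : set R := `[lo k n, hi k n]%classic.
pose D : set R := `[a n, b n]%classic.
have mI k : measurable (I k) by exact: measurable_itv.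
have mD : measurable D by exact: measurable_itv.
have mcI k : measurable_fun D (fun t => (c k * \1_(I k) t)%:E).
  by apply/measurable_EFinP; apply: measurable_funM.
have slice t : D t ->
    ((\prod_(i < n) (b i - a i))%:E <= \sum_(k <oo) (c k * \1_(I k) t)%:E)%E.
  rewrite /D/= in_itv/= => tab.
  apply: (le_trans (IH a b (fun k => P k && (lo k n <= t <= hi k n)) lo hi _ _ _)).
  - by move=> i ni; apply: ab; rewrite ltnS ltnW.
  - by move=> k i /andP[Pk _] ni; apply: lohi => //; rewrite ltnS ltnW.
  - move=> x xab.
    have [i|k Pk kx] := cov (fun i => if (i < n)%N then x i else t).
      rewrite ltnS leq_eqVlt => /orP[/eqP->|ni]; first by rewrite ltnn.
      by rewrite ni; exact: xab.
    exists k; first by rewrite Pk; have := kx n (ltnSn n); rewrite ltnn.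
    by move=> i ni; have := kx i (ltnW ni); rewrite ni.
  apply: lee_nneseries => [k _ _|k _].
    case: ifP => // /andP[Pk _]; rewrite lee_fin prodr_ge0// => i _.
    by rewrite subr_ge0 lohi// ltnS ltnW.
  rewrite /c indicE mem_setE /= in_itv/=; case: (P k) => /=; last by rewrite mul0r.
  by case: ifP => _; rewrite ?mulr1 ?mulr0.
have intD : (\int[@lebesgue_measure R]_(t in D) (\prod_(i < n) (b i - a i))%:E =
    (\prod_(i < n.+1) (b i - a i))%:E)%E.
  rewrite integral_cst// big_ord_recr/= EFinM; congr (_ * _)%E.
  rewrite lebesgue_measure_itv/= lte_fin; case: ltP => // ba.
  have /eqP -> : a n == b n by rewrite eq_le ba ab.
  by rewrite subrr.
rewrite -intD; apply: (@le_trans _ _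
    (\int[@lebesgue_measure R]_(t in D) (\sum_(k <oo) (c k * \1_(I k) t)%:E))%E).
  apply: ge0_le_integral => //.
  - by move=> t _; rewrite lee_fin prodr_ge0// => i _; rewrite subr_ge0 ab// ltnS ltnW.
  - apply: (ge0_emeasurable_sum (P := xpredT)) => [|k _]; last exact: mcI.
    by move=> k t _ _; rewrite lee_fin mulr_ge0.
rewrite integral_nneseries//; last by move=> k t _; rewrite lee_fin mulr_ge0.
apply: lee_nneseries => [k _ _|k _].
  by apply: integral_ge0 => t _; rewrite lee_fin mulr_ge0.
under eq_integral do rewrite EFinM.
rewrite ge0_integralZl_EFin//; last first.
  by apply/measurable_EFinP; apply: measurable_indic; exact: mI.
rewrite integral_indic; [|exact: mD|exact: mI].
rewrite /c; case: ifPn => Pk; last by rewrite mul0e.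
rewrite big_ord_recr/= EFinM lee_wpmul2l//.
  by move: (c_ge0 k); rewrite /c Pk lee_fin.
apply: (@le_trans _ _ (@lebesgue_measure R (I k))).
  by apply: le_measure; rewrite ?inE;
    [apply: measurableI; [exact: mI|exact: mD]|exact: mI|move=> t []].
rewrite lebesgue_measure_itv/= lte_fin; case: ltP => // ba.
by rewrite lee_fin subr_ge0 lohi.
Qed.

Section LebesgueOuter.
Context {R : realType} {n : nat}.
Local Notation vol := (fun ab : 'rV[R]_n * 'rV[R]_n => (\prod_(i < n) (ab.2 0 i - ab.1 0 i))%:E).

Lemma lebesgue_outer_box_ge (a b : 'rV[R]_n) : (forall i, a 0 i <= b 0 i) ->
  ((\prod_(i < n) (b 0 i - a 0 i))%:E <= lebesgue_outer (box (a, b)))%E.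
Proof.
move=> ab; apply: le_ereal_inf_tmp => _ [F [DF covF] <-].
(* the value 0 outside the range of coordinates is never looked at *)
pose ext (x : 'rV[R]_n) (i : nat) := if insub i is Some j then x 0 j else 0.
have extE x (i : 'I_n) : ext x i = x 0 i by rewrite /ext valK.
pose lo k := ext (odflt (0, 0) (F k)).1.
pose hi k := ext (odflt (0, 0) (F k)).2.
have prodE : \prod_(i < n) (b 0 i - a 0 i) = \prod_(i < n) (ext b i - ext a i).
  by apply: eq_bigr => i _; rewrite !extE.
rewrite prodE.
apply: le_trans (prod_length_le_cover (P := fun k => isSome (F k)) (lo := lo) (hi := hi) _ _ _) _.
- by move=> i ni; rewrite -[i]/(val (Ordinal ni)) !extE.
- move=> k i Fk ni; rewrite -[i]/(val (Ordinal ni)) /lo /hi !extE.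
  by case: (F k) Fk (DF k) => //= ab' _ /(_ _ erefl).
- move=> x xab; have [|k _ Fx] := covF (\row_i x i).
    by move=> i /=; rewrite !mxE; have := xab i (ltn_ord i); rewrite !extE.
  exists k; first by case: (F k) Fx.
  move=> i ni; rewrite /lo /hi; case: (F k) Fx => //= ab' /(_ (Ordinal ni)).
  by rewrite mxE -!extE.
apply: lee_nneseries => [k _ _|k _].
  case E : (F k) => [q|]//=; rewrite lee_fin prodr_ge0// => i _.
  by rewrite subr_ge0 /lo /hi E !extE; exact: DF E _.
rewrite /lo /hi; case: (F k) => //= q.
by rewrite (eq_bigr (fun i => q.2 0 i - q.1 0 i))// => i _; rewrite !extE.
Qed.

Lemma lebesgue_outer_box_le (a b : 'rV[R]_n) : (forall i, a 0 i <= b 0 i) ->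
  (lebesgue_outer (box (a, b)) <= (\prod_(i < n) (b 0 i - a 0 i))%:E)%E.
Proof.
move=> ab; apply: ereal_inf_lbound.
exists (fun k => if k == 0%N then Some (a, b) else None).
  by split => [[|k] i //= [<-]//|x xab]; exists 0%N.
rewrite nneseries_recl//; last first.
  by case=> //= _; rewrite lee_fin prodr_ge0// => i _; rewrite subr_ge0.
by rewrite eseries0 ?adde0//; case.
Qed.

(** A hyperplane orthogonal to an axis cuts a box into two boxes whose volumes add
    up to the original one, so every cover can be cut along with the set. *)
Lemma lebesgue_half_space (i : 'I_n) (c : R) :
  (@lebesgue_outer R n).-caratheodory [set x : 'rV[R]_n | x 0 i <= c].
Proof.
apply: le_caratheodory_measurable => X; apply: le_ereal_inf_tmp => _ [F [DF covF] <-].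
pose upd (x : 'rV[R]_n) (t : R) : 'rV[R]_n := \row_j if j == i then t else x 0 j.
have updi x t : upd x t 0 i = t by rewrite mxE eqxx.
have updj x t j : j != i -> upd x t 0 j = x 0 j by rewrite mxE => /negbTE ->.
pose low (q : 'rV[R]_n * 'rV[R]_n) := if q.1 0 i <= c
  then Some (q.1, upd q.2 (Num.min (q.2 0 i) c)) else None.
pose up (q : 'rV[R]_n * 'rV[R]_n) := if c <= q.2 0 i
  then Some (upd q.1 (Num.max (q.1 0 i) c), q.2) else None.
have Dlow k q : obind low (F k) = Some q -> forall j, q.1 0 j <= q.2 0 j.
  case E : (F k) => [q'|]//=; rewrite /low; case: ifP => // qc [<-] j /=.
  have [->|ji] := eqVneq j i; last by rewrite updj// (DF _ _ E).
  by rewrite updi le_min qc (DF _ _ E).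
have Dup k q : obind up (F k) = Some q -> forall j, q.1 0 j <= q.2 0 j.
  case E : (F k) => [q'|]//=; rewrite /up; case: ifP => // qc [<-] j /=.
  have [->|ji] := eqVneq j i; last by rewrite updj// (DF _ _ E).
  by rewrite updi ge_max qc (DF _ _ E).
apply: (@le_trans _ _ (\sum_(k <oo) oapp vol 0 (obind low (F k)) +
                      \sum_(k <oo) oapp vol 0 (obind up (F k)))%E).
  apply: leeD; apply: ereal_inf_lbound.
    exists (fun k => obind low (F k)) => //; split; first exact: Dlow.
    move=> x [Xx xc]; have [k _ Fx] := covF x Xx; exists k => //.
    case: (F k) Fx => //= q qx; rewrite /low ifT; last first.
      by have /andP[+ _] := qx i; move=> /le_trans; apply.
    move=> j /=; have [->|ji] := eqVneq j i; last by rewrite updj// qx.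
    by rewrite updi le_min xc andbT qx.
  exists (fun k => obind up (F k)) => //; split; first exact: Dup.
  move=> x [Xx /negP]; rewrite -ltNge => cx; have [k _ Fx] := covF x Xx; exists k => //.
  case: (F k) Fx => //= q qx; rewrite /up ifT; last first.
    by have /andP[_] := qx i; apply: le_trans; exact: ltW.
  move=> j /=; have [->|ji] := eqVneq j i; last by rewrite updj// qx.
  by rewrite updi ge_max (ltW cx) andbT qx.
have vol_ge0 (q : option ('rV[R]_n * 'rV[R]_n)) :
    (forall q', q = Some q' -> forall j, q'.1 0 j <= q'.2 0 j) -> (0 <= oapp vol 0 q)%E.
  case: q => [q'|]//= /(_ _ erefl) h; rewrite lee_fin prodr_ge0// => j _.
  by rewrite subr_ge0.
rewrite -nneseriesD; last 2 first.
- by move=> k _ _; apply: vol_ge0 => q /Dlow.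
- by move=> k _ _; apply: vol_ge0 => q /Dup.
apply: lee_nneseries => [k _ _|k _].
  by apply: adde_ge0; apply: vol_ge0 => q; [move/Dlow|move/Dup].
case E : (F k) => [[a b]|]/=; last by rewrite adde0.
have ab j : a 0 j <= b 0 j by exact: (DF _ _ E).
pose rest := \prod_(j < n | j != i) (b 0 j - a 0 j).
have volE : \prod_(j < n) (b 0 j - a 0 j) = (b 0 i - a 0 i) * rest by rewrite (bigD1 i).
have volL t : \prod_(j < n) (upd b t 0 j - a 0 j) = (t - a 0 i) * rest.
  by rewrite (bigD1 i)//= updi; congr (_ * _); apply: eq_bigr => j ji; rewrite updj.
have volU t : \prod_(j < n) (b 0 j - upd a t 0 j) = (b 0 i - t) * rest.
  by rewrite (bigD1 i)//= updi; congr (_ * _); apply: eq_bigr => j ji; rewrite updj.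
rewrite volE /low /up /=; have abi := ab i.
have rest0 : 0 <= rest by apply: prodr_ge0 => j _; rewrite subr_ge0.
case: ifPn => ac; case: ifPn => cb /=; rewrite ?volL ?volU -?EFinD ?addr0 ?add0r lee_fin.
- by rewrite -mulrDl (min_idPr cb) (max_idPr ac); nra.
- by move: cb; rewrite -ltNge => cb; rewrite (min_idPl (ltW cb)).
- by move: ac; rewrite -ltNge => ca; rewrite (max_idPl (ltW ca)).
- by rewrite mulr_ge0// subr_ge0.
Qed.

Lemma open_lebesgue_measurable (U : set 'rV[R]_n) :
  open U -> (@lebesgue_outer R n).-caratheodory U.
Proof. by apply: open_caratheodory; exact: lebesgue_half_space. Qed.

End LebesgueOuter.

(** * Convex bodies and their centroid *)

Lemma continuous_caratheodory_measurable {R : realType} {n : nat}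
    (mu : {outer_measure set 'rV[R]_n -> \bar R}) (D : set 'rV[R]_n)
    (f : 'rV[R]_n -> R) :
  (forall U, open U -> mu.-caratheodory U) -> {within D, continuous f} ->
  measurable_fun (D : set (caratheodory_type mu)) f.
Proof.
move=> muo /continuousP cf mD.
apply: (measurability _ (RGenOpens.measurableE R)) => //.
move=> _ [_ [a [b ->] <-]].
have /cf/open_subspaceP[V oV] : open (`]a, b[%classic : set R) by exact: interval_open.
by rewrite setIC [in X in _ -> X]setIC => <-; apply: caratheodory_measurable_setI => //; exact: muo.
Qed.

Lemma cvg_sumr {R : realType} {T I : Type} (F : set_system T) {FF : Filter F}
    (r : seq I) (f : I -> T -> R) (l : I -> R) :
  (forall i, f i x @[x --> F] --> l i) ->
  \sum_(i <- r) f i x @[x --> F] --> \sum_(i <- r) l i.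
Proof. by move=> fl; apply: cvg_big => //; exact: add_continuous. Qed.

Lemma continuous_dot {R : realType} {n : nat} (u : 'rV[R]_n) : continuous (fun x => dot x u).
Proof.
move=> x; apply: (cvg_sumr (F := nbhs x)) => i; apply: cvgM; last exact: cvg_cst.
exact: coord_continuous.
Qed.

Section ConvexBody.
Context {R : realType} {n : nat} (K : set 'rV[R]_n).
Hypothesis cK : convex_body K.

Lemma convex_body_closed : closed K.
Proof. by case: cK => cptK _ _; apply: compact_closed => //; exact: norm_hausdorff. Qed.

Lemma convex_bodyP x y t : K x -> K y -> 0 <= t <= 1 -> K (t *: x + (1 - t) *: y).
Proof.
move=> Kx Ky /andP[t0 t1]; case: cK => _ cvx _.
have := cvx x y (@Itv01 R t t0 t1).
by rewrite !inE; exact.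
Qed.

Lemma boundary_convex_body : boundary K = K `\` K°.
Proof. by rewrite /boundary -(closure_id K).1//; exact: convex_body_closed. Qed.

Lemma volume_convex_body_gt0 : (0 < lebesgue_outer K)%E.
Proof.
case: cK => _ _ [c]; rewrite /interior/= => /nbhs_ballP[e /= e0 eK].
pose a : 'rV[R]_n := \row_i (c 0 i - e / 2); pose b : 'rV[R]_n := \row_i (c 0 i + e / 2).
have ab i : a 0 i <= b 0 i by rewrite !mxE; lra.
apply: (@lt_le_trans _ _ (lebesgue_outer (box (a, b)))).
  apply: lt_le_trans (lebesgue_outer_box_ge ab); rewrite lte_fin prodr_gt0// => i _.
  by rewrite !mxE; lra.
apply: le_outer_measure => x xab; apply: eK; split => // j i; rewrite (ord1 j).
have := xab i; rewrite /= !mxE => /andP[h1 h2].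
by rewrite /ball/= ltr_norml; apply/andP; split; lra.
Qed.

Lemma convex_body_bounded : exists2 M, 0 < M & forall x i, K x -> `|x 0 i| <= M.
Proof.
case: cK => /compact_bounded[M [Mr MK]] _ _; exists (`|M| + 1).
  by rewrite ltr_wpDl.
move=> x i Kx; apply: le_trans (ler_coord_norm _ _) _.
by apply: MK => //; rewrite (le_lt_trans (ler_norm _))// ltrDl.
Qed.

Lemma volume_convex_body_lty : (lebesgue_outer K < +oo)%E.
Proof.
have [M M0 KM] := convex_body_bounded.
apply: (@le_lt_trans _ _ (lebesgue_outer (box (- const_mx M, const_mx M)))).
  apply: le_outer_measure => x Kx i; rewrite !mxE.
  by have := KM x i Kx; rewrite ler_norml.
apply: le_lt_trans (lebesgue_outer_box_le _) _; last by rewrite ltry.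
by move=> i; rewrite !mxE; lra.
Qed.

(** Moving from the nearest point z towards y cannot decrease the norm. *)
Lemma nearest_point_separates : exists2 z, K z & forall y, K y -> dot z z <= dot y z.
Proof.
case: cK => cptK _ [c /interior_subset Kc].
have [||z zK zmin] := @EVT_min_rV R n (fun x => dot x x) K _ cptK.
- by exists c.
- apply: continuous_subspaceT => x; apply: (cvg_sumr (F := nbhs x)) => i.
  by apply: cvgM; exact: coord_continuous.
exists z; first by rewrite inE in zK.
rewrite inE in zK; move=> y Ky; rewrite leNgt; apply/negP => yz.
pose d := dot (y - z) (y - z).
have d0 : 0 <= d by exact: dot_ge0.
pose g := dot z z - dot y z.
have g0 : 0 < g by rewrite subr_gt0.
have dg : 0 < d + g by lra.
(* any step shorter than 2 g / d, and at most 1, decreases the norm *)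
pose t := g / (d + g).
have t01 : 0 < t <= 1.
  by rewrite divr_gt0//= ler_pdivrMr//; lra.
have /andP[t0 t1] := t01.
have := zmin (t *: y + (1 - t) *: z).
rewrite inE => /(_ (convex_bodyP Ky zK _)); rewrite ltW//= => /(_ t1).
pose w := y - z.
have -> : t *: y + (1 - t) *: z = z + t *: w.
  by rewrite scalerBl scale1r scalerBr addrCA.
have wz : dot w z = - g by rewrite dotBl opprB.
rewrite dotDl !dotDr !dotZl !dotZr (dotC z w) wz -/d => min_t.
have tdg : t * (d + g) = g by rewrite /t divfK// gt_eqF.
have : 0 <= t * (t * d - 2 * g) by lra.
rewrite pmulr_rge0//; have := mulr_gt0 t0 g0; lra.
Qed.

(** Otherwise y.z >= z.z > 0 on the body, where z is its nearest point to the
    origin.  The integral of y.z is then positive, because the volume is; but it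
    is zero, because that of each coordinate is.  Positivity and finiteness of the
    volume also ensure that the centroid is not a quotient by zero. *)
Lemma centroid0_mem : centroid K = 0 -> K 0.
Proof.
move=> cen0; have [z Kz zK] := nearest_point_separates.
have [z0|z0] := eqVneq z 0; first by rewrite -z0.
exfalso.
have mK : (@lebesgue_outer R n).-caratheodory K.
  have /closed_openC/open_lebesgue_measurable := convex_body_closed.
  by move/caratheodory_measurable_setC; rewrite setCK.
pose mK' : measurable (K : set (caratheodory_type (@lebesgue_outer R n))) := mK.
have [M M0 KM] := convex_body_bounded.
have int_coord (f : 'rV[R]_n -> R) : continuous f -> (exists B, forall x, K x -> `|f x| <= B) ->
    (volume R n).-integrable K (EFin \o f).
  move=> cf [B KB]; apply: measurable_bounded_integrable => //.
  - exact: volume_convex_body_lty.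
  - apply: continuous_caratheodory_measurable; first exact: open_lebesgue_measurable.
    exact: continuous_subspaceT.
  - exists B; split; first exact: num_real.
    by move=> y By x Kx /=; apply: le_trans (KB x Kx) (ltW By).
have icoord i : (volume R n).-integrable K (EFin \o (fun x : 'rV[R]_n => x 0 i)).
  apply: int_coord; first exact: coord_continuous.
  by exists M => x Kx; exact: KM.
have vol0 : 0 < fine (volume R n K).
  by rewrite fine_gt0// volume_convex_body_gt0 volume_convex_body_lty.
have coord0 i : (\int[volume R n]_(x in K) (x 0 i)%:E = 0)%E.
  have := congr1 (fun v : 'rV[R]_n => v 0 i) cen0; rewrite !mxE => /eqP.
  rewrite mulf_eq0 invr_eq0 (gt_eqF vol0) orbF => /eqP fine0.
  rewrite -[LHS]fineK ?(integrable_fin_num _ (icoord i))//.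
  by congr EFin.
have dot0 : (\int[volume R n]_(x in K) (dot x z)%:E = 0)%E.
  under eq_integral do rewrite /dot -sumEFin.
  rewrite integral_sum//.
    apply: big1 => i _; under eq_integral do rewrite mulrC EFinM.
    transitivity ((z 0 i)%:E * (\int[volume R n]_(x in K) (x 0 i)%:E))%E.
      exact: (integralZl mK' (icoord i) (z 0 i)).
    by rewrite coord0 mule0.
  move=> i; have := integrableZr mK' (z 0 i) (icoord i).
  apply: eq_integrable; first exact: mK'.
  by move=> x _; rewrite /= EFinM.
have : ((dot z z)%:E * volume R n K <= 0)%E.
  rewrite -dot0 -integral_cst//; apply: le_integral => //.
  - apply: (int_coord (fun=> dot z z)); first exact: cst_continuous.
    by exists `|dot z z|.
  - apply: (int_coord (fun x => dot x z)); first exact: continuous_dot.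
    exists (\sum_(i < n) M * `|z 0 i|) => x Kx.
    apply: le_trans (ler_norm_sum _ _ _) _; apply: ler_sum => i _.
    by rewrite normrM ler_wpM2r// KM.
  - by move=> x /[!inE] Kx; rewrite lee_fin zK.
rewrite leNgt mule_gt0 ?lte_fin ?dot_gt0//.
exact: volume_convex_body_gt0.
Qed.

End ConvexBody.

(** * Gradients, limits of matrices and directions of approach *)

Section Gradient.
Context {R : realType} {n : nat}.
Implicit Types (f : 'rV[R]_n -> R) (x y v : 'rV[R]_n).

Definition gradient f x : 'rV[R]_n := \row_i 'D_(delta_mx 0 i) f x.

Lemma derive_gradient f x v : differentiable f x -> 'D_v f x = dot v (gradient f x).
Proof.
move=> df; rewrite deriveE// {1}(row_sum_delta v) linear_sum.
by apply: eq_bigr => i _; rewrite linearZ /= mxE deriveE.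
Qed.

Lemma gradient_expansion f x (e : R) : differentiable f x -> 0 < e ->
  \forall y \near x, `|f y - f x - dot (y - x) (gradient f x)| <= e * `|y - x|.
Proof.
move=> df e0; have /eqaddoP/(_ e e0) := diff_locally df.
rewrite nearE/= => /nbhs_ballP[d /= d0 dP]; apply/nbhs_ballP; exists d => //= y xy.
have := dP (y - x); rewrite -ball_normE/= sub0r normrN distrC.
rewrite -ball_normE/= in xy; move=> /(_ xy).
by rewrite !fctE /= subrK opprD addrA -deriveE// derive_gradient.
Qed.

End Gradient.

Section MatrixLimits.
Context {R : realType} {T : Type} (F : set_system T) {FF : Filter F}.

(** Entrywise convergence: unlike convergence in the topology of matrices it is stable
    under products of rectangular matrices by limits of sums of products. *)
Definition mxcvg m p (f : T -> 'M[R]_(m, p)) (l : 'M[R]_(m, p)) :=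
  forall i j, f t i j @[t --> F] --> l i j.

Lemma mxcvg_cst m p (l : 'M[R]_(m, p)) : mxcvg (fun=> l) l.
Proof. by move=> i j; exact: cvg_cst. Qed.

Lemma eq_mxcvg m p (f g : T -> 'M[R]_(m, p)) l :
  f =1 g -> mxcvg f l -> mxcvg g l.
Proof. by move=> /funext ->. Qed.

Lemma mxcvgD m p (f g : T -> 'M[R]_(m, p)) a b :
  mxcvg f a -> mxcvg g b -> mxcvg (fun t => f t + g t) (a + b).
Proof.
move=> fa gb i j; under eq_fun do rewrite mxE.
by rewrite mxE; apply: cvgD; [exact: fa|exact: gb].
Qed.

Lemma mxcvgN m p (f : T -> 'M[R]_(m, p)) a :
  mxcvg f a -> mxcvg (fun t => - f t) (- a).
Proof. by move=> fa i j; under eq_fun do rewrite mxE; rewrite mxE; apply: cvgN; exact: fa. Qed.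

Lemma mxcvgZ m p (c : T -> R) (f : T -> 'M[R]_(m, p)) (k : R) a :
  c t @[t --> F] --> k -> mxcvg f a -> mxcvg (fun t => c t *: f t) (k *: a).
Proof.
move=> ck fa i j; under eq_fun do rewrite mxE.
by rewrite mxE; apply: cvgM => //; exact: fa.
Qed.

Lemma mxcvgM m p q (f : T -> 'M[R]_(m, p)) (g : T -> 'M[R]_(p, q)) a b :
  mxcvg f a -> mxcvg g b -> mxcvg (fun t => f t *m g t) (a *m b).
Proof.
move=> fa gb i j; under eq_fun do rewrite mxE; rewrite mxE.
by apply: cvg_sumr => k; apply: cvgM; [exact: fa|exact: gb].
Qed.

Lemma mxcvgT m p (f : T -> 'M[R]_(m, p)) a :
  mxcvg f a -> mxcvg (fun t => (f t)^T) a^T.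
Proof. by move=> fa i j; under eq_fun do rewrite mxE; rewrite mxE; exact: fa. Qed.

Lemma cvg_dot n (f g : T -> 'rV[R]_n) a b :
  mxcvg f a -> mxcvg g b -> dot (f t) (g t) @[t --> F] --> dot a b.
Proof.
by move=> fa gb; apply: cvg_sumr => k; apply: cvgM; [exact: fa|exact: gb].
Qed.

Lemma mxcvg_norm_le n (f : T -> 'rV[R]_n) a (e : T -> R) :
  e t @[t --> F] --> 0 -> (\forall t \near F, `|f t - a| <= e t) -> mxcvg f a.
Proof.
move=> e0 fe i j; apply/cvgrPdist_le => d d0.
have /cvgr0_norm_lt/(_ _ d0) := e0.
apply: filterS2 fe => t fe /= ed.
rewrite distrC; apply: le_trans (le_trans (ler_norm _) (ltW ed)).
by apply: le_trans fe; have := ler_coord_norm (f t - a) j; rewrite !mxE (ord1 i).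
Qed.

Lemma mxcvg_unique {PF : ProperFilter F} m p (f : T -> 'M[R]_(m, p)) a b :
  mxcvg f a -> mxcvg f b -> a = b.
Proof.
by move=> fa fb; apply/matrixP => i j; apply: cvg_unique (fa i j) (fb i j); exact: norm_hausdorff.
Qed.

End MatrixLimits.

Section Contingent.
Context {R : realType} {n : nat}.
Implicit Types (S : set 'rV[R]_n) (x v : 'rV[R]_n).

(** The Bouligand contingent cone of S at x.  A single parameter bounds both the step
    and the relative error. *)
Definition contingent S x v := forall e : R, 0 < e ->
  exists t y, [/\ 0 < t < e, S y & `|y - x - t *: v| <= e * t].

(** If directions of approach to the union fail at some scale for the first set,
    then from that scale on they are realized in the second. *)
Lemma contingentU S1 S2 x v : contingent (S1 `|` S2) x v ->
  contingent S1 x v \/ contingent S2 x v.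
Proof.
move=> cU; have [c1|] := pselect (contingent S1 x v); first by left.
move=> /existsNP[e1 /not_implyP[e10 c1]]; right => e e0.
have m0 : 0 < Num.min e e1 by rewrite lt_min e0.
have [t [y [/andP[t0 te] + yt]]] := cU _ m0.
have te' : t < e by apply: lt_le_trans te _; rewrite ge_min lexx.
have te1 : t < e1 by apply: lt_le_trans te _; rewrite ge_min lexx orbT.
case=> Sy; last first.
  exists t, y; split => //; first by rewrite t0.
  by apply: le_trans yt _; apply: ler_wpM2r; [exact: ltW|by rewrite ge_min lexx].
exfalso; apply: c1; exists t, y; split => //; first by rewrite t0.
by apply: le_trans yt _; apply: ler_wpM2r; [exact: ltW|by rewrite ge_min lexx orbT].
Qed.

(** The explicit rate keeps the quotients bounded, which entrywise convergence alone
    would only give through a finite maximum. *)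
Definition approach S x v (t : nat -> R) (y : nat -> 'rV[R]_n) :=
  [/\ forall k, 0 < t k, forall k, S (y k), t k @[k --> \oo] --> 0,
      y k @[k --> \oo] --> x &
      forall k, `|(t k)^-1 *: (y k - x) - v| <= k.+1%:R^-1].

Lemma approach_cvg S x v t y : approach S x v t y ->
  mxcvg \oo (fun k => (t k)^-1 *: (y k - x)) v.
Proof.
case=> _ _ _ _ q; apply: (mxcvg_norm_le (@cvg_harmonic R)).
by apply: nearW => k /=; exact: q.
Qed.

Lemma contingent_approach S x v : contingent S x v ->
  exists t y, approach S x v t y.
Proof.
move=> cS.
have ex k : exists ty : R * 'rV[R]_n, [/\ 0 < ty.1, ty.1 < k.+1%:R^-1, S ty.2 &
    `|ty.2 - x - ty.1 *: v| <= k.+1%:R^-1 * ty.1].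
  have [|t [y [/andP[t0 tk] Sy yt]]] := cS k.+1%:R^-1; first by rewrite invr_gt0.
  by exists (t, y).
have [u uP] := choice ex; exists (fst \o u), (snd \o u).
have harm : (fun k => k.+1%:R^-1 : R) k @[k --> \oo] --> 0 := @cvg_harmonic R.
have t0 : (u k).1 @[k --> \oo] --> 0.
  apply: (squeeze_cvgr _ (cvg_cst 0) harm); apply: nearW => k.
  by have [/ltW -> /ltW ->] := uP k.
split => //.
- by move=> k; have [] := uP k.
- by move=> k; have [] := uP k.
- apply/cvgrPdist_le => e e0.
  have c0 : 0 < 1 + `|v| by rewrite ltr_wpDr.
  have /cvgr0_norm_le/(_ (e / (1 + `|v|)))[] := t0; first by rewrite divr_gt0.
  move=> N _ tN; exists N => // k /tN /= tk.
  have [tk0 tk1 _ yt] := uP k; rewrite distrC.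
  rewrite gtr0_norm// ler_pdivlMr// in tk.
  apply: le_trans tk; rewrite -[X in `|X|](subrK ((u k).1 *: v)).
  apply: le_trans (ler_normD _ _) _; rewrite normrZ gtr0_norm// mulrDr mulr1 lerD2r.
  apply: le_trans yt _; rewrite ler_piMl ?(ltW tk0)//.
  by rewrite invf_le1// ler1n.
- move=> k; have [tk0 tk1 _ yt] := uP k.
  have -> : (u k).1^-1 *: ((u k).2 - x) - v = (u k).1^-1 *: ((u k).2 - x - (u k).1 *: v).
    by rewrite [RHS]scalerBr scalerA mulVf ?scale1r// gt_eqF.
  by rewrite normrZ gtr0_norm ?invr_gt0// ler_pdivrMl// mulrC.
Qed.

End Contingent.

(** * First order structure of a boundary: tangent directions and normals *)

Section FirstOrder.
Context {R : realType} {n : nat}.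
Implicit Types (S K U : set 'rV[R]_n) (x y v u : 'rV[R]_n) (g : 'rV[R]_n -> R).

(** B acts on row vectors from the right, as in [is_weingarten]. *)
Definition deriv_along S (f : 'rV[R]_n -> 'rV[R]_n) x (B : 'M[R]_n) :=
  forall e : R, 0 < e -> \forall y \near within S (nbhs x),
    `|f y - f x - (y - x) *m B| <= e * `|y - x|.

(** Difference quotients along a sequence approaching x in direction v converge to
    the value of the derivative at v. *)
Lemma deriv_along_cvg S f x B v (t : nat -> R) (y : nat -> 'rV[R]_n) :
  deriv_along S f x B -> approach S x v t y ->
  mxcvg \oo (fun k => (t k)^-1 *: (f (y k) - f x)) (v *m B).
Proof.
move=> dB app; have qv := approach_cvg app; have [t0 Sy tk yk qk] := app.
suff rem : mxcvg \oo (fun k => (t k)^-1 *: (f (y k) - f x - (y k - x) *m B)) 0.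
  have h := [elaborate mxcvgD (mxcvgM qv (mxcvg_cst (l := B))) rem]; rewrite addr0 in h.
  apply: eq_mxcvg h => k; rewrite -scalemxAl -scalerDr; congr (_ *: _).
  by rewrite addrC subrK.
move=> i j; rewrite (ord1 i) mxE; apply/cvgr0Pnorm_le => e e0.
have V0 : 0 < 1 + `|v| by rewrite ltr_wpDr.
have e1 : 0 < e / (1 + `|v|) by rewrite divr_gt0.
have dBk : \forall k \near \oo, S (y k) ->
    `|f (y k) - f x - (y k - x) *m B| <= e / (1 + `|v|) * `|y k - x|.
  exact: yk (dB _ e1).
apply: filterS dBk => k /(_ (Sy k)) dk.
apply: le_trans (ler_coord_norm _ j) _.
rewrite normrZ gtr0_norm ?invr_gt0// ler_pdivrMl//.
apply: le_trans dk _; rewrite -mulrA [leRHS]mulrC; apply: ler_wpM2l; first exact: ltW.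
rewrite ler_pdivrMl// [leRHS]mulrC.
have -> : y k - x = t k *: ((t k)^-1 *: (y k - x)) by rewrite scalerA mulfV ?scale1r ?gt_eqF.
rewrite normrZ gtr0_norm//; apply: ler_wpM2l; first exact: ltW.
have := ler_normD ((t k)^-1 *: (y k - x) - v) v.
rewrite subrK => /le_trans; apply; rewrite lerD2r.
by apply: le_trans (qk k) _; rewrite invf_le1// ler1n.
Qed.

(** A supporting halfspace contains all directions of approach. *)
Lemma support_contingent S x u v : (forall y, S y -> dot (y - x) u <= 0) ->
  contingent S x v -> dot v u <= 0.
Proof.
move=> Su /contingent_approach[t [y app]].
have := [elaborate cvg_dot (approach_cvg app) (mxcvg_cst (l := u))]; have [t0 Sy _ _ _] := app.
move=> /ler_cvg_to/(_ (cvg_cst 0)); apply; apply: nearW => k /=.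
by rewrite dotZl mulr_ge0_le0 ?invr_ge0 ?(ltW (t0 k))// Su.
Qed.

(** Near x + t v the function g changes sign along the gradient within a distance
    that is negligible with respect to t, so the intermediate value theorem
    provides a zero there. *)
Lemma level_set_contingent U g x v : open U ->
  (forall y, U y -> differentiable g y) -> U x -> g x = 0 ->
  gradient g x != 0 -> dot v (gradient g x) = 0 ->
  contingent [set y | U y /\ g y = 0] x v.
Proof.
move=> oU dg Ux gx0; set c := gradient g x => c0 vc e e0.
pose w := (dot c c)^-1 *: c.
have wc : dot w c = 1 by rewrite dotZl mulVf// gt_eqF// dot_gt0.
clearbody w.
have W1 : 0 < `|w| + 1 by rewrite ltr_wpDl.
(* points x + t v + s w with s at most e' t in absolute value stay within e t of
   x + t v, and within t B of x; eta makes the first order error at most e' t / 2 *)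
pose e' := e / (`|w| + 1); have e'0 : 0 < e' by rewrite divr_gt0.
have e'w : e' * `|w| <= e.
  rewrite -[leRHS](divfK (lt0r_neq0 W1)) -/e' ler_wpM2l ?(ltW e'0)//.
  by rewrite lerDl.
pose B := `|v| + e' * `|w| + 1.
have B0 : 0 < B by rewrite ltr_wpDl// addr_ge0// mulr_ge0// ltW.
pose eta := e' / (2 * B); have eta0 : 0 < eta by rewrite divr_gt0// mulr_gt0.
have /nbhs_ballP[r /= r0 rP] : \forall z \near x,
    `|g z - g x - dot (z - x) c| <= eta * `|z - x| /\ U z.
  apply: filterI; first by apply: gradient_expansion => //; exact: dg.
  by apply: open_nbhs_nbhs.
pose t := Num.min (e / 2) (r / (2 * B)).
have t0 : 0 < t by rewrite lt_min !divr_gt0// mulr_gt0.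
have te : t < e.
  by rewrite (@le_lt_trans _ _ (e / 2)) ?ge_min ?lexx//; lra.
have tB : t * B < r.
  apply: (@le_lt_trans _ _ (r / (2 * B) * B)).
    by rewrite ler_wpM2r ?(ltW B0)// ge_min lexx orbT.
  rewrite invfM mulrA divfK ?gt_eqF//; lra.
pose z (s : R) := x + (t *: v + s *: w).
have zx s : z s - x = t *: v + s *: w by rewrite /z addrC addKr.
have e't0 : 0 < e' * t by rewrite mulr_gt0.
have zn s : `|s| <= e' * t -> `|z s - x| <= t * B.
  move=> st; rewrite zx; apply: le_trans (ler_normD _ _) _.
  rewrite !normrZ gtr0_norm// /B !mulrDr -addrA lerD2l.
  apply: (@le_trans _ _ (t * (e' * `|w|))); last by rewrite lerDl mulr1 ltW.
  by rewrite mulrA (mulrC t) ler_wpM2r.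
have zball s : `|s| <= e' * t -> ball x r (z s).
  by move=> /zn h; rewrite -ball_normE/= distrC (le_lt_trans h).
have gz s : `|s| <= e' * t -> `|g (z s) - s| <= e' * t / 2.
  move=> st; have [+ _] := rP _ (zball _ st).
  rewrite gx0 subr0 [X in dot X _]zx dotDl !dotZl vc wc mulr0 add0r mulr1.
  rewrite distrC => /le_trans; apply.
  apply: (@le_trans _ _ (eta * (t * B))); first by rewrite ler_wpM2l ?(ltW eta0)// zn.
  rewrite /eta le_eqVlt; apply/orP; left; apply/eqP; field.
  by rewrite gt_eqF.
have gpos : 0 < g (z (e' * t)).
  have := gz (e' * t); rewrite gtr0_norm// lexx ler_norml => /(_ isT) /andP[h _]; lra.
have gneg : g (z (- (e' * t))) < 0.
  have := gz (- (e' * t)); rewrite normrN gtr0_norm// lexx ler_norml => /(_ isT) /andP[_ h]; lra.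
have [|||s sI gs] := @IVT R (g \o z) (- (e' * t)) (e' * t) 0.
- by lra.
- apply: continuous_in_subspaceT => s; rewrite inE/= in_itv/= -ler_norml => st.
  apply: continuous_comp; last first.
    by apply: differentiable_continuous; apply: dg; have [_] := rP _ (zball _ st).
  apply: cvgD; first exact: cvg_cst.
  apply: cvgD; first exact: cvg_cst.
  by apply: cvgZ; [exact: cvg_id|exact: cvg_cst].
- by rewrite /= ge_min le_max (ltW gneg) (ltW gpos) orbT.
rewrite in_itv/= -ler_norml in sI.
exists t, (z s); split; first by rewrite t0.
  by split => //; have [_] := rP _ (zball _ sI).
rewrite zx addrC addKr normrZ.
apply: (@le_trans _ _ (e' * t * `|w|)); first by rewrite ler_wpM2r.
by rewrite mulrAC ler_wpM2r// ltW.
Qed.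

End FirstOrder.

Section Normals.
Context {R : realType} {n : nat} (K : set 'rV[R]_n).
Hypothesis cK : convex_body K.
Implicit Types (U : set 'rV[R]_n) (x y v u c : 'rV[R]_n) (g : 'rV[R]_n -> R).

Lemma interior_segment c y t : K° c -> K y -> 0 < t <= 1 -> K° (t *: c + (1 - t) *: y).
Proof.
rewrite /interior/= => /nbhs_ballP[r /= r0 rK] Ky /andP[t0 t1].
apply/nbhs_ballP; exists (t * r); first by rewrite /= mulr_gt0.
move=> z; rewrite -ball_normE/= => zt.
have -> : z = t *: (c - t^-1 *: (t *: c + (1 - t) *: y - z)) + (1 - t) *: y.
  by apply/rowP => i; rewrite !mxE; field; rewrite gt_eqF.
apply: (convex_bodyP cK) => //; last by rewrite (ltW t0).
apply: rK; rewrite -ball_normE/= opprB addrCA subrr addr0 normrZ gtr0_norm ?invr_gt0//.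
by rewrite ltr_pdivrMl.
Qed.

Lemma boundary_mem x : boundary K x -> K x.
Proof. by rewrite boundary_convex_body// => -[]. Qed.

Lemma boundary_not_interior x : boundary K x -> ~ K° x.
Proof. by rewrite boundary_convex_body// => -[]. Qed.

(** If the direction away from an interior point c were approached in the boundary,
    x would lie between a boundary point and a point close to c, hence inside. *)
Lemma contingent_not_interior x c : boundary K x -> K° c ->
  ~ contingent (boundary K) x (x - c).
Proof.
move=> Kx Kc cont; apply: (boundary_not_interior Kx).
have /nbhs_ballP[r /= r0 rK] : nbhs c K°.
  by apply: open_nbhs_nbhs; split => //; exact: open_interior.
have r20 : 0 < r / 2 by lra.
have [t [y [/andP[t0 _] /boundary_mem Ky yt]]] := cont _ r20.
(* x is a convex combination of y and of the point c - q / t, which is close to c *)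
pose q := y - x - t *: (x - c).
have qE : q = y - x - t *: (x - c) by [].
have Kc' : K° (c - t^-1 *: q).
  apply: rK; rewrite -ball_normE/= opprB addrCA subrr addr0 normrZ.
  rewrite gtr0_norm ?invr_gt0// ltr_pdivrMl// mulrC (le_lt_trans yt)//.
  by rewrite ltr_pM2r//; lra.
have t1 : 0 < 1 + t by lra.
have tt : 0 < t / (1 + t) <= 1.
  by rewrite divr_gt0//= ler_pdivrMr//; lra.
have -> : x = (t / (1 + t)) *: (c - t^-1 *: q) + (1 - t / (1 + t)) *: y.
  have -> : 1 - t / (1 + t) = (1 + t)^-1 by field; rewrite gt_eqF.
  rewrite [t / _]mulrC -scalerA -scalerDr; apply: (canRL (scalerK _)).
    by rewrite gt_eqF.
  rewrite scalerBr scalerA mulfV ?gt_eqF// scale1r qE.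
  apply/rowP => i; rewrite !mxE; ring.
exact: interior_segment.
Qed.

Definition boundary_chart U g :=
  [/\ open U, C2_on U g & boundary K `&` U = [set y | U y /\ g y = 0]].

Section Chart.
Context (U : set 'rV[R]_n) (g : 'rV[R]_n -> R) (x : 'rV[R]_n).
Hypotheses (chart : boundary_chart U g) (Kx : boundary K x) (Ux : U x).
Local Notation G := (gradient g x).
Hypothesis G0 : G != 0.

Lemma chart_contingent v : dot v G = 0 -> contingent (boundary K) x v.
Proof.
case: chart => oU [dg _] KU vG.
have gx : g x = 0 by have : (boundary K `&` U) x by []; rewrite KU => -[].
have := level_set_contingent oU (fun y Uy => (dg y Uy).1) Ux gx G0 vG.
by rewrite -KU => cont e e0; have [t [y [te [Ky _] yt]]] := cont e e0; exists t, y.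
Qed.

(** Otherwise the direction from c to x would be tangent. *)
Lemma chart_transversal c : K° c -> dot (c - x) G != 0.
Proof.
move=> Kc; apply/eqP => cG; apply: (contingent_not_interior Kx Kc).
by apply: chart_contingent; rewrite -opprB dotNl cG oppr0.
Qed.

(** If y lies strictly on the other side of the tangent hyperplane than the interior
    point c, then the segment from c to y meets this hyperplane in an interior
    point, which is impossible. *)
Lemma chart_support c (a : R) : a != 0 -> K° c -> dot (c - x) (a *: G) < 0 ->
  forall y, K y -> dot (y - x) (a *: G) <= 0.
Proof.
move=> a0 Kc; set w := a *: G => cw y Ky; rewrite leNgt; apply/negP => yw.
(* the segment meets the tangent hyperplane at the barycentric weight t of c *)
pose p := dot (y - x) w; pose q := - dot (c - x) w.
have p0 : 0 < p by []. have q0 : 0 < q by rewrite oppr_gt0.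
pose t := p / (p + q).
have pq : 0 < p + q by rewrite addr_gt0.
have t01 : 0 < t <= 1 by rewrite divr_gt0//= ler_pdivrMr// mul1r lerDl ltW.
have := chart_transversal (interior_segment Kc Ky t01).
apply/negP; rewrite negbK.
have -> : t *: c + (1 - t) *: y - x = t *: (c - x) + (1 - t) *: (y - x).
  by apply/rowP => i; rewrite !mxE; ring.
rewrite -(mulrI_eq0 _ (mulfI a0)) -dotZr -/w dotDl !dotZl -/p.
have -> : dot (c - x) w = - q by rewrite opprK.
by apply/eqP; rewrite /t; field; rewrite gt_eqF.
Qed.

Definition is_normal u := enorm u = 1 /\ forall y, K y -> dot (y - x) u <= 0.

(** The vector on the right supports K by [chart_support].  Conversely a normal u is
    orthogonal to every vector v orthogonal to the gradient, since both v and -v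
    are directions of approach; so u is a multiple of the gradient, and an interior
    point fixes the sign. *)
Lemma chart_normalP c u : K° c ->
  is_normal u <-> u = (- Num.sg (dot (c - x) G) / enorm G) *: G.
Proof.
move=> Kc; have s0 := chart_transversal Kc; set s := dot _ _ in s0 *.
have eG : 0 < enorm G by rewrite sqrtr_gt0 dot_gt0.
pose a := - Num.sg s / enorm G.
have a0 : a != 0 by rewrite mulf_neq0 ?oppr_eq0 ?sgr_eq0// invr_eq0 gt_eqF.
split => [[u1 uK]|->]; last first.
  split.
    rewrite enormZ normrM normrN normr_sg s0 mul1r normfV gtr0_norm// mulVf//.
    by rewrite gt_eqF.
  apply: (chart_support a0 Kc).
  rewrite dotZr -/s /a mulrAC mulNr -normrEsg mulNr oppr_lt0 divr_gt0//.
  by rewrite normr_gt0.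
have uperp v : dot v G = 0 -> dot v u = 0.
  move=> vG; apply/eqP; rewrite eq_le.
  have uS y : boundary K y -> dot (y - x) u <= 0 by move/boundary_mem/uK.
  rewrite (support_contingent uS (chart_contingent vG))/=.
  rewrite -oppr_le0 -dotNl; apply: (support_contingent uS); apply: chart_contingent.
  by rewrite dotNl vG oppr0.
pose b := dot u G / dot G G.
have uE : u = b *: G.
  apply/eqP; rewrite -subr_eq0; apply/eqP/dot_eq0.
  have wG : dot (u - b *: G) G = 0.
    by rewrite dotBl dotZl divfK ?subrr// gt_eqF// dot_gt0.
  by rewrite dotBr dotZr wG mulr0 subr0 uperp.
have bG : `|b| * enorm G = 1 by rewrite -enormZ -uE.
have bs : b * s < 0.
  rewrite lt_neqAle mulf_eq0 (negbTE s0) orbF; apply/andP; split.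
    by apply/eqP => b0; move: bG; rewrite b0 normr0 mul0r => /esym/eqP; rewrite oner_eq0.
  by rewrite -dotZr -uE; apply: uK; exact: interior_subset.
rewrite {1}uE; congr (_ *: _); apply: (mulIf (lt0r_neq0 eG)).
rewrite divfK ?gt_eqF//.
case: (ltgtP s 0) s0 bs bG => [sl|sg|->] _.
- rewrite ltr0_sg// opprK nmulr_llt0// => b0; by rewrite gtr0_norm.
- rewrite gtr0_sg// pmulr_llt0// => b0; rewrite ltr0_norm// => <-; by rewrite mulNr opprK.
- by rewrite mulr0 ltxx.
Qed.

End Chart.
End Normals.

(** * Second order structure of a boundary: the Weingarten map *)

Lemma near_eq_mxcvg {R : realType} {T : Type} (F : set_system T) {FF : Filter F}
    m p (f g : T -> 'M[R]_(m, p)) l :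
  (\forall t \near F, f t = g t) -> mxcvg F f l -> mxcvg F g l.
Proof.
move=> fg fl i j; apply: cvg_trans (fl i j); apply: near_eq_cvg.
by apply: filterS fg => t ->.
Qed.

Lemma mulmx_rV_inj {R : realType} m p (A B : 'M[R]_(m, p)) :
  (forall w : 'rV[R]_m, w *m A = w *m B) -> A = B.
Proof. by move=> AB; apply/row_matrixP => i; rewrite !rowE. Qed.

Lemma mul_tangent_proj {R : realType} n (N v : 'rV[R]_n) :
  v *m (1%:M - N^T *m N) = v - dot v N *: N.
Proof. by rewrite mulmxBr mulmx1 mulmxA [v *m _]mx11_scalar -dotE mul_scalar_mx. Qed.

Section ChartSecondOrder.
Context {R : realType} {n : nat} (K : set 'rV[R]_n).
Hypothesis cK : convex_body K.
Context (U : set 'rV[R]_n) (g : 'rV[R]_n -> R).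
Hypothesis chart : boundary_chart K U g.
Implicit Types (x y v u c : 'rV[R]_n).
Local Notation N := (outer_normal K).
Local Notation G := (gradient g).

Definition hessian (h : 'rV[R]_n -> R) x : 'M[R]_n :=
  \matrix_(i, j) 'D_(delta_mx 0 i) ('D_(delta_mx 0 j) h) x.

Lemma chart_gradient_cvg x : U x -> mxcvg (nbhs x) G (G x).
Proof.
case: chart => _ [C1g _] _ Ux i j; under eq_fun do rewrite mxE.
by rewrite mxE; have [_ ] := C1g x Ux; exact.
Qed.

Lemma chart_hessian_cvg x : U x -> mxcvg (nbhs x) (hessian g) (hessian g x).
Proof.
case: chart => _ [_ C2g] _ Ux i j; under eq_fun do rewrite mxE.
by rewrite mxE; have [_ ] := C2g (delta_mx 0 j) x Ux; exact.
Qed.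

Lemma chart_gradient_deriv S x : U x -> deriv_along S G x (hessian g x).
Proof.
case: chart => _ [_ C2g] _ Ux e e0.
pose small j y := `|'D_(delta_mx 0 j) g y - 'D_(delta_mx 0 j) g x -
    dot (y - x) (gradient ('D_(delta_mx 0 j) g) x)| <= e * `|y - x|.
suff : \forall y \near x, forall j, small j y.
  apply: filterS => y yj _; apply: norm_rV_le => [|j].
    by rewrite mulr_ge0// ltW.
  have := yj j; rewrite !mxE; congr (`|_ - _| <= _).
  by apply: eq_bigr => i _; rewrite !mxE.
apply: (@filter_forall _ _ small (nbhs x) _) => j; apply: gradient_expansion => //.
by have [] := C2g (delta_mx 0 j) x Ux.
Qed.

Lemma chart_outer_normal c y : K° c -> boundary K y -> U y -> G y != 0 ->
  N y = (- Num.sg (dot (c - y) (G y)) / enorm (G y)) *: G y.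
Proof.
move=> Kc Ky Uy G0; rewrite /outer_normal.
have nP u := chart_normalP cK chart Ky Uy G0 u Kc.
case: xgetP => [u _ /nP//|/(_ ((- Num.sg (dot (c - y) (G y)) / enorm (G y)) *: G y))[]].
exact/nP.
Qed.

Lemma chart_near_regular x : U x -> G x != 0 -> \forall y \near x, U y /\ G y != 0.
Proof.
move=> Ux G0; apply: filterI.
  by case: chart => oU _ _; exact: (open_nbhs_nbhs (conj oU Ux)).
have GG := [elaborate cvg_dot (chart_gradient_cvg Ux) (chart_gradient_cvg Ux)].
have Gpos := [elaborate cvgr_gt _ GG 0 (dot_gt0 G0)]; apply: filterS Gpos => y /= Gy.
by apply: contraTneq Gy => ->; rewrite dot0l ltxx.
Qed.

(** Let M = l G, which extends N up to a positive factor rho and equals N at x.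
    Along a sequence approaching x in a tangent direction v, the quotients of N tend
    to v A and those of M to v (l H); as M = rho N with rho tending to 1 and N(x) P
    = 0, these limits agree after projection by P.  Moreover v A is already
    orthogonal to N(x), because N has constant length. *)
Lemma chart_weingarten c x A : K° c -> boundary K x -> U x -> G x != 0 ->
  is_weingarten K x A ->
  A = (1%:M - (N x)^T *m N x) *m
      ((- Num.sg (dot (c - x) (G x)) / enorm (G x)) *: hessian g x) *m
      (1%:M - (N x)^T *m N x).
Proof.
move=> Kc Kx Ux G0 [NA dN].
have NE y : boundary K y -> U y -> G y != 0 -> _ := @chart_outer_normal c y Kc.
have NN y : boundary K y -> U y -> G y != 0 -> dot (N y) (N y) = 1.
  move=> Ky Uy Gy0; have [|/enorm_eq1//] := (chart_normalP cK chart Ky Uy Gy0 (N y) Kc).2 _.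
  exact: NE.
set l := _ / enorm (G x); set P := 1%:M - _.
have NxE : N x = l *: G x by exact: NE.
have NP : N x *m P = 0 by rewrite mul_tangent_proj NN// scale1r subrr.
have tang v : dot v (N x) = 0 -> v *m A = v *m (l *: hessian g x) *m P.
  move=> vN; have vG : dot v (G x) = 0.
    move: vN; rewrite NxE dotZr => /eqP; rewrite mulf_eq0 => /orP[/eqP l0|/eqP//].
    by have := NN x Kx Ux G0; rewrite NxE l0 scale0r dot0l => /esym/eqP; rewrite oner_eq0.
  have /contingent_approach[t [y app]] := chart_contingent chart Kx Ux G0 vG.
  have Dk := deriv_along_cvg dN app.
  have [t0 Ky tk yk _] := app.
  have Gk := deriv_along_cvg (@chart_gradient_deriv (boundary K) x Ux) app.
  pose M y := l *: G y.
  have Ek : mxcvg \oo (fun k => (t k)^-1 *: (M (y k) - N x)) (l *: (v *m hessian g x)).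
    have := [elaborate mxcvgZ (cvg_cst l) Gk]; apply: eq_mxcvg => k.
    by rewrite NxE -scalerBr !scalerA mulrC.
  have limN : mxcvg \oo (fun k => N (y k)) (N x).
    have := [elaborate mxcvgD (mxcvg_cst (l := N x)) (mxcvgZ tk Dk)].
    rewrite scale0r addr0; apply: eq_mxcvg => k.
    by rewrite scalerA mulfV ?gt_eqF// scale1r addrC subrK.
  have limM : mxcvg \oo (fun k => M (y k)) (N x).
    have := [elaborate mxcvgD (mxcvg_cst (l := N x)) (mxcvgZ tk Ek)].
    rewrite scale0r addr0; apply: eq_mxcvg => k.
    by rewrite scalerA mulfV ?gt_eqF// scale1r addrC subrK.
  have reg : \forall k \near \oo, U (y k) /\ G (y k) != 0.
    exact: yk (chart_near_regular Ux G0).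
  have rho := [elaborate cvg_dot limM limN]; rewrite NN// in rho.
  have EP := [elaborate mxcvgM Ek (mxcvg_cst (l := P))].
  have DP := [elaborate mxcvgZ rho (mxcvgM Dk (mxcvg_cst (l := P)))].
  have E1 : l *: (v *m hessian g x) *m P = v *m A *m P.
    rewrite scale1r in DP; apply: (mxcvg_unique EP); move: DP.
    apply: near_eq_mxcvg; apply: filterS reg => k [Uk Gk0].
    rewrite -!scalemxAl !mulmxBl NP !subr0 scalerA mulrC -scalerA; congr (_ *: _).
    have NkE := NE _ (Ky k) Uk Gk0; set a := _ / _ in NkE.
    have := NN _ (Ky k) Uk Gk0.
    rewrite /M dotZl NkE !dotZr dotZl => h.
    rewrite -!scalemxAl scalerA; congr (_ *: _).
    by rewrite -[RHS]mulr1 -h; ring.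
  (* N y and N x are unit vectors, so (N y - N x).(N x) = - |N y - N x|^2 / 2 *)
  have E2 : dot (v *m A) (N x) = 0.
    have lhs := [elaborate cvg_dot Dk (mxcvg_cst (l := N x))].
    have DD := [elaborate cvg_dot Dk Dk].
    have rhs := [elaborate cvgM (cvgM (cvg_cst (- 2^-1 : R)) tk) DD].
    rewrite mulr0 mul0r in rhs.
    apply: (cvg_unique _ lhs); first exact: norm_hausdorff.
    apply: cvg_trans rhs; apply: near_eq_cvg.
    apply: filterS reg => k [Uk Gk0] /=.
    rewrite !dotZl dotZr !(dotBl, dotBr) (dotC (N x) (N (y k))).
    by rewrite !NN//; field; rewrite gt_eqF.
  by rewrite -scalemxAr E1 mul_tangent_proj E2 scale0r subr0.
apply: mulmx_rV_inj => w.
rewrite !mulmxA -tang.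
  by rewrite mul_tangent_proj mulmxBl -scalemxAl NA scaler0 subr0.
by rewrite mul_tangent_proj dotBl dotZl NN// mulr1 subrr.
Qed.

End ChartSecondOrder.

Section C2Body.
Context {R : realType} {n : nat} (K : set 'rV[R]_n).
Hypotheses (cK : convex_body K) (C2K : C2_boundary K).
Implicit Types (x y v u c : 'rV[R]_n).
Local Notation N := (outer_normal K).

Lemma C2_chart x : boundary K x -> exists U g,
  [/\ boundary_chart K U g, U x & gradient g x != 0].
Proof.
move=> /C2K[U [g [[oU Ux] C2g [v gv] KU]]]; exists U, g; split => //.
apply: contraNneq gv => g0; rewrite derive_gradient ?g0 ?dot0r//.
by have [/(_ x Ux)[]] := C2g.
Qed.

Lemma is_normalE x u : boundary K x ->
  (enorm u = 1 /\ forall y, K y -> dot (y - x) u <= 0) <-> u = N x.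
Proof.
move=> Kx; have [U [g [chart Ux G0]]] := C2_chart Kx.
have [_ _ [c Kc]] := cK.
rewrite (chart_outer_normal cK chart Kc Kx Ux G0).
exact: (chart_normalP cK chart Kx Ux G0 u Kc).
Qed.

Lemma enorm_outer_normal x : boundary K x -> enorm (N x) = 1.
Proof. by move=> Kx; have [] := (is_normalE (N x) Kx).2 erefl. Qed.

Lemma dot_outer_normal x : boundary K x -> dot (N x) (N x) = 1.
Proof. by move/enorm_outer_normal/enorm_eq1. Qed.

Lemma outer_normal_support x y : boundary K x -> K y -> dot (y - x) (N x) <= 0.
Proof. by move=> Kx; have [_] := (is_normalE (N x) Kx).2 erefl; exact. Qed.

Lemma tangent_contingent x v : boundary K x -> dot v (N x) = 0 ->
  contingent (boundary K) x v.
Proof.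
move=> Kx vN; have [U [g [chart Ux G0]]] := C2_chart Kx.
apply: (chart_contingent chart Kx Ux G0).
have [_ _ [c Kc]] := cK; move: vN (dot_outer_normal Kx).
rewrite (chart_outer_normal cK chart Kc Kx Ux G0) dotZr => /eqP.
rewrite mulf_eq0 => /orP[/eqP -> |/eqP//].
by rewrite scale0r dot0l => /esym/eqP; rewrite oner_eq0.
Qed.

(** The formula does not involve A, so it entails uniqueness. *)
Lemma weingarten_chartE x : boundary K x -> exists B : 'M[R]_n, forall A,
  is_weingarten K x A ->
  A = (1%:M - (N x)^T *m N x) *m B *m (1%:M - (N x)^T *m N x).
Proof.
move=> Kx; have [U [g [chart Ux G0]]] := C2_chart Kx; have [_ _ [c Kc]] := cK.
by eexists => A; exact: (chart_weingarten cK chart Kc Kx Ux G0).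
Qed.

Lemma weingarten_unique x A B : boundary K x ->
  is_weingarten K x A -> is_weingarten K x B -> A = B.
Proof. by move=> /weingarten_chartE[C CE] /CE -> /CE ->. Qed.

Lemma weingarten_mul_normal x A : boundary K x -> is_weingarten K x A ->
  A *m (N x)^T = 0.
Proof.
move=> Kx wA; have [B /(_ A wA) ->] := weingarten_chartE Kx.
suff PN : (1%:M - (N x)^T *m N x) *m (N x)^T = 0.
  by rewrite -(mulmxA _ _ ((N x)^T)) PN mulmx0.
rewrite mulmxBl mul1mx -mulmxA [N x *m _]mx11_scalar -dotE dot_outer_normal//.
by rewrite mulmx1 subrr.
Qed.

(** Near x both maps are given on the boundary by the formulas in terms of the
    gradient and the Hessian; the sign in them is locally constant since it is that
    of a nonvanishing continuous function. *)
Lemma weingarten_cvg x (W : 'rV[R]_n -> 'M[R]_n) :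
  (forall y, boundary K y -> is_weingarten K y (W y)) -> boundary K x ->
  mxcvg (within (boundary K) (nbhs x)) N (N x) /\
  mxcvg (within (boundary K) (nbhs x)) W (W x).
Proof.
move=> wW Kx; have [U [g [chart Ux G0]]] := C2_chart Kx; have [_ _ [c Kc]] := cK.
set F := within _ _.
have FF : Filter F by exact: within_filter.
pose s y := dot (c - y) (gradient g y).
have regF : \forall y \near F, [/\ boundary K y, U y & gradient g y != 0].
  have := chart_near_regular chart Ux G0.
  by rewrite /F /within/=; apply: filterS => y [Uy Gy] Ky.
have toF m p (f : 'rV[R]_n -> 'M[R]_(m, p)) l : mxcvg (nbhs x) f l -> mxcvg F f l.
  by move=> fl i j; apply: cvg_within_filter; exact: fl.
have limG : mxcvg F (gradient g) (gradient g x) by apply/toF/(chart_gradient_cvg chart Ux).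
have limH : mxcvg F (hessian g) (hessian g x) by apply/toF/(chart_hessian_cvg chart Ux).
have limid : mxcvg F id x by apply/toF => i j; exact: coord_continuous.
have lims : s y @[y --> F] --> s x.
  apply: cvg_dot limG; apply: mxcvgD; first exact: mxcvg_cst.
  exact: mxcvgN.
have s0 : s x != 0 by exact: (chart_transversal cK chart Kx Ux G0).
have eG0 : enorm (gradient g x) != 0 by rewrite gt_eqF// sqrtr_gt0 dot_gt0.
pose l y := - Num.sg (s y) / enorm (gradient g y).
have liml : l y @[y --> F] --> l x.
  apply: cvgM; last first.
    apply: cvgV => //; rewrite /enorm.
    apply: (@continuous_cvg _ _ _ F _ _ (@Num.sqrt R)); first exact: sqrt_continuous.
    exact: cvg_dot.
  have sgE : {near F, cst (Num.sg (s x)) =1 Num.sg \o s}.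
    have [sp|sn|/eqP] := ltgtP 0 (s x); last by rewrite eq_sym (negbTE s0).
      have pos := [elaborate cvgr_gt _ lims 0 sp].
      by apply: filterS pos => y sy; rewrite /= !gtr0_sg.
    have neg := [elaborate cvgr_lt _ lims 0 sn].
    by apply: filterS neg => y sy; rewrite /= !ltr0_sg.
  apply: cvgN; apply: (cvg_trans (near_eq_cvg sgE)); exact: cvg_cst.
have NE y : boundary K y -> U y -> gradient g y != 0 -> N y = l y *: gradient g y.
  by move=> Ky Uy Gy; exact: (chart_outer_normal cK chart Kc Ky Uy Gy).
have limN : mxcvg F N (N x).
  rewrite (NE x)//; apply: near_eq_mxcvg (mxcvgZ liml limG).
  by apply: filterS regF => y [Ky Uy Gy]; rewrite NE.
split => //.
have limP : mxcvg F (fun y => 1%:M - (N y)^T *m N y) (1%:M - (N x)^T *m N x).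
  apply: mxcvgD; first exact: mxcvg_cst.
  by apply: mxcvgN; apply: mxcvgM => //; exact: mxcvgT.
rewrite (chart_weingarten cK chart Kc Kx Ux G0 (wW x Kx)).
apply: near_eq_mxcvg (mxcvgM (mxcvgM limP (mxcvgZ liml limH)) limP).
apply: filterS regF => y [Ky Uy Gy].
by rewrite [RHS](chart_weingarten cK chart Kc Ky Uy Gy (wW y Ky)).
Qed.

(** Monotonicity of the normals, (N y - N x).(y - x) >= 0, passes to the limit
    along directions of approach and gives (v A).v >= 0 for tangent v. *)
Lemma weingarten_ge0 x A v (k : R) : boundary K x -> is_weingarten K x A ->
  v != 0 -> v *m A = k *: v -> 0 <= k.
Proof.
move=> Kx wA v0 vA; have [->|k0] := eqVneq k 0; first by [].
have vN : dot v (N x) = 0.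
  apply/eqP; rewrite -(mulrI_eq0 _ (mulfI k0)) -dotZl -vA dot_mulmxl.
  have -> : N x *m A^T = 0.
    by rewrite -[LHS]trmxK trmx_mul trmxK (weingarten_mul_normal Kx wA) trmx0.
  by rewrite dot0r.
have /contingent_approach[t [y app]] := tangent_contingent Kx vN.
have [_ dN] := wA; have Dk := deriv_along_cvg dN app.
have := [elaborate cvg_dot Dk (approach_cvg app)].
rewrite vA dotZl => lim; have [t0 Ky _ _ _] := app.
rewrite -(pmulr_lge0 _ (dot_gt0 v0)).
apply: (ler_cvg_to (cvg_cst 0) lim); apply: nearW => j /=.
rewrite dotZl dotZr !mulr_ge0 ?invr_ge0 ?(ltW (t0 j))//.
have h1 := outer_normal_support Kx (boundary_mem cK (Ky j)).
have := outer_normal_support (Ky j) (boundary_mem cK Kx).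
rewrite -opprB dotNl oppr_le0 => h2.
by rewrite dotC dotBr subr_ge0 (le_trans h1).
Qed.

End C2Body.

Lemma weingarten_contingent {R : realType} {n : nat} (S K M : set 'rV[R]_n) x A B v :
  S `<=` boundary K -> S `<=` boundary M ->
  (forall y, S y -> outer_normal K y = outer_normal M y) ->
  outer_normal K x = outer_normal M x ->
  is_weingarten K x A -> is_weingarten M x B -> contingent S x v ->
  v *m A = v *m B.
Proof.
move=> SK SM SN xN [_ dK] [_ dM] /contingent_approach[t [y app]].
have appW Z : S `<=` Z -> approach Z x v t y.
  by move=> SZ; case: app => ? Sy ? ? ?; split => // k; exact/SZ/Sy.
have [_ Sy _ _ _] := app.
apply: (mxcvg_unique (deriv_along_cvg dK (appW _ SK))).
apply: eq_mxcvg (deriv_along_cvg dM (appW _ SM)) => k.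
by rewrite SN// xN.
Qed.

(** Each tangent direction of M is approached in the boundary of K or in that of L,
    so on each tangent vector A agrees with B or with C.  The two subspaces where it
    does cover the space, hence one of them is everything. *)
Lemma weingarten_contact {R : realType} {n : nat} (M K L : set 'rV[R]_n) x A B C :
  convex_body M -> C2_boundary M -> boundary M x ->
  boundary M `<=` boundary K `|` boundary L ->
  (forall y, boundary M y -> boundary K y -> outer_normal M y = outer_normal K y) ->
  (forall y, boundary M y -> boundary L y -> outer_normal M y = outer_normal L y) ->
  boundary K x -> boundary L x ->
  is_weingarten M x A -> is_weingarten K x B -> is_weingarten L x C ->
  A = B \/ A = C.
Proof.
move=> cM C2M Mx MKL NK NL Kx Lx wA wB wC.
have dich (v : 'rV[R]_n) : v *m (A - B) = 0 \/ v *m (A - C) = 0.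
  have split_v := mul_tangent_proj (outer_normal M x) v.
  set w := v *m _ in split_v.
  have wN : dot w (outer_normal M x) = 0.
    by rewrite split_v dotBl dotZl (dot_outer_normal cM C2M Mx) mulr1 subrr.
  have vE : v = w + dot v (outer_normal M x) *: outer_normal M x by rewrite split_v subrK.
  have red D : w *m A = w *m D -> outer_normal M x *m D = 0 -> v *m (A - D) = 0.
    move=> wAD ND; rewrite vE mulmxBr !mulmxDl -!scalemxAl ND wA.1 wAD.
    by rewrite subrr.
  have := tangent_contingent cM C2M Mx wN.
  have -> : boundary M = (boundary M `&` boundary K) `|` (boundary M `&` boundary L).
    by rewrite -setIUr; apply/esym/setIidPl.
  case/contingentU => cont; [left|right]; apply: red.
  - apply: (weingarten_contingent (@subIsetl _ _ _) (@subIsetr _ _ _) _ (NK _ Mx Kx) wA wB cont).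
    by move=> y [My Ky]; exact: NK.
  - by rewrite NK//; case: wB.
  - apply: (weingarten_contingent (@subIsetl _ _ _) (@subIsetr _ _ _) _ (NL _ Mx Lx) wA wC cont).
    by move=> y [My Ly]; exact: NL.
  - by rewrite NL//; case: wC.
have [->|AB] := eqVneq A B; first by left.
have [->|AC] := eqVneq A C; first by right.
exfalso.
have ex D : A - D != 0 -> exists v : 'rV[R]_n, v *m (A - D) != 0.
  move=> D0; apply: contrapT => /forallNP h; move/eqP: D0; apply.
  by apply: mulmx_rV_inj => w; rewrite mulmx0; apply/eqP/negPn/negP/h.
have [v vB] : exists v : 'rV[R]_n, v *m (A - B) != 0 by apply: ex; rewrite subr_eq0.
have [w wCC] : exists v : 'rV[R]_n, v *m (A - C) != 0 by apply: ex; rewrite subr_eq0.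
have [vB0|vC0] := dich v; first by rewrite vB0 eqxx in vB.
have [wB0|wC0] := dich w; last by rewrite wC0 eqxx in wCC.
have := dich (v + w); rewrite !mulmxDl wB0 vC0 addr0 add0r => -[h|h].
  by rewrite h eqxx in vB.
by rewrite h eqxx in wCC.
Qed.

(** * Elementary symmetric functions and characteristic polynomials *)

Section ElementarySymmetric.
Context {R : realType} {m : nat}.
Implicit Types (kappa : 'rV[R]_m).

Definition esymm kappa (j : nat) : R :=
  \sum_(J : {set 'I_m} | #|J| == j) \prod_(l in J) kappa 0 l.

(** Vieta's formula, by expanding the product over the subsets of indices that
    contribute their root. *)
Lemma coef_prod_XsubC_esymm kappa (j : nat) : (j <= m)%N ->
  (\prod_(l < m) ('X - (kappa 0 l)%:P))`_(m - j) = (-1) ^+ j * esymm kappa j.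
Proof.
move=> jm; under eq_bigr do rewrite addrC.
have termE (J : {set 'I_m}) : \prod_(l < m) (if l \in J then - (kappa 0 l)%:P else 'X) =
    ((-1) ^+ #|J| * \prod_(l in J) kappa 0 l)%:P * 'X^(m - #|J|).
  rewrite (bigID (mem J))/=; congr (_ * _).
    rewrite -prodr_const -big_split/= rmorph_prod/=; apply: eq_bigr => l lJ.
    by rewrite lJ mulN1r polyCN.
  rewrite (eq_bigr (fun=> 'X)); last by move=> l /negbTE ->.
  rewrite prodr_const; congr ('X^_).
  have JC := cardC (mem J); rewrite card_ord in JC.
  apply/eqP; rewrite -(eqn_add2l #|J|) subnKC; last by rewrite (leq_trans (max_card _)) ?card_ord.
  apply/eqP; apply: etrans JC; congr (_ + _)%N.
rewrite bigA_distr coef_sum /esymm mulr_sumr (bigID (fun J : {set 'I_m} => #|J| == j))/=.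
rewrite [X in _ + X]big1 ?addr0 => [|J Jj].
  by apply: eq_bigr => J /eqP Jj; rewrite termE Jj coefCM coefXn eqxx mulr1.
rewrite termE coefCM coefXn; case: eqP => [mj|_]; last by rewrite mulr0.
have Jm : (#|J| <= m)%N by rewrite (leq_trans (max_card _)) ?card_ord.
by move: Jj; rewrite -(subKn Jm) -mj (subKn jm) eqxx.
Qed.

Lemma esymm_scale kappa (c : R) j : esymm (c *: kappa) j = c ^+ j * esymm kappa j.
Proof.
rewrite /esymm mulr_sumr; apply: eq_bigr => J /eqP <-.
rewrite -prodr_const -big_split/=; apply: eq_bigr => l _.
by rewrite !mxE.
Qed.

Lemma esymm_ge0 kappa j : (forall l, 0 <= kappa 0 l) -> 0 <= esymm kappa j.
Proof. by move=> k0; apply: sumr_ge0 => J _; apply: prodr_ge0. Qed.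

End ElementarySymmetric.

Section CharPoly.
Context {R : realType} {T : Type} (F : set_system T) {FF : Filter F}.

Definition polycvg (p : T -> {poly R}) (l : {poly R}) :=
  forall k, (p t)`_k @[t --> F] --> l`_k.

Lemma polycvgM p q a b : polycvg p a -> polycvg q b ->
  polycvg (fun t => p t * q t) (a * b).
Proof.
move=> pa qb k; under eq_fun do rewrite coefM; rewrite coefM.
by apply: cvg_sumr => i; apply: cvgM; [exact: pa|exact: qb].
Qed.

Lemma polycvg_prod (I : Type) (r : seq I) (p : I -> T -> {poly R}) a :
  (forall i, polycvg (p i) (a i)) ->
  polycvg (fun t => \prod_(i <- r) p i t) (\prod_(i <- r) a i).
Proof.
move=> pa; elim: r => [|i r ih].
  by move=> k; under eq_fun do rewrite big_nil; rewrite big_nil; exact: cvg_cst.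
move=> k; under eq_fun do rewrite big_cons; rewrite big_cons.
exact: polycvgM.
Qed.

Lemma char_poly_cvg n (A : T -> 'M[R]_n) (B : 'M[R]_n) :
  mxcvg F A B -> polycvg (fun t => char_poly (A t)) (char_poly B).
Proof.
move=> AB k; rewrite /char_poly /determinant.
under eq_fun do rewrite coef_sum; rewrite coef_sum.
apply: cvg_sumr => s; apply: polycvgM; first by move=> j; exact: cvg_cst.
apply: polycvg_prod => i j; under eq_fun do rewrite !mxE coefB coefC.
rewrite !mxE coefB coefC; apply: cvgB; first exact: cvg_cst.
by case: ifP => _; [exact: AB|exact: cvg_cst].
Qed.

End CharPoly.

(** X - c B = c (X/c - B), so the characteristic polynomial of c B is obtained from
    that of B by substitution. *)
Lemma char_poly_scale_conj {R : realType} n (c : R) (Q A : 'M[R]_n) :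
  c != 0 -> Q *m Q^T = 1%:M ->
  char_poly (c *: (Q^T *m A *m Q)) = c ^+ n *: (char_poly A \Po (c^-1 *: 'X)).
Proof.
move=> c0 QQ; have QQ' : Q^T *m Q = 1%:M by exact: mulmx1C.
pose q := map_mx (@polyC R) Q.
pose M : 'M[{poly R}]_n := map_mx (comp_poly (c^-1 *: 'X)) (char_poly_mx A).
have qq : q^T *m q = 1%:M by rewrite matrix.map_trmx -map_mxM QQ' map_mx1.
have ME : char_poly_mx (c *: (Q^T *m A *m Q)) = c%:P *: (q^T *m M *m q).
  rewrite /char_poly_mx.
  have -> : M = (c^-1 *: 'X)%:M - map_mx polyC A.
    apply/matrixP => i j; rewrite !mxE rmorphB /= comp_polyC rmorphMn /= comp_polyX.
    by [].
  rewrite mulmxBr mulmxBl scalerBr; congr (_ - _).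
    rewrite -[in RHS]mulmxA mul_scalar_mx -scalemxAr qq scalerA -mul_polyC mulrA -polyCM.
    by rewrite mulfV// mul1r scalemx1.
  by rewrite map_mxZ !map_mxM -matrix.map_trmx.
rewrite /char_poly ME detZ !det_mulmx mulrAC -det_mulmx qq det1 mul1r /M.
by rewrite det_map_mx -[RHS]mul_polyC polyC_exp.
Qed.

(** * Mean curvatures and the integrand *)

Lemma coef_char_poly_curvatures {R : realType} n j (kappa : 'rV[R]_n.-1) (q : {poly R}) :
  (0 < n)%N -> (j <= n.-1)%N -> q = 'X * \prod_(l < n.-1) ('X - (kappa 0 l)%:P) ->
  esymm kappa j = (-1) ^+ j * q`_(n - j).
Proof.
move=> n0 jn ->; rewrite coefXM subn_eq0 leqNgt.
have -> : (j < n)%N by rewrite -(prednK n0) ltnS.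
have -> : (n - j).-1 = (n.-1 - j)%N by lia.
by rewrite /= coef_prod_XsubC_esymm// mulrA -exprMn mulrNN mulr1 expr1n mul1r.
Qed.

Lemma mean_curvature_esymm {R : realType} n (K : set 'rV[R]_n) j x :
  mean_curvature K j x = 'C(n.-1, j)%:R^-1 * esymm (principal_curvatures K x) j.
Proof. by []. Qed.

(** The principal curvatures are chosen among all listings of the eigenvalues of all
    Weingarten maps; when the map is unique the choice does not matter for symmetric
    functions. *)
Lemma mean_curvature_eq {R : realType} n (K : set 'rV[R]_n) x (A : 'M[R]_n)
    (kappa : 'rV[R]_n.-1) j : (0 < n)%N -> (j <= n.-1)%N ->
  (forall B, is_weingarten K x B -> B = A) -> is_weingarten K x A ->
  char_poly A = 'X * \prod_(l < n.-1) ('X - (kappa 0 l)%:P) ->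
  mean_curvature K j x = 'C(n.-1, j)%:R^-1 * esymm kappa j.
Proof.
move=> n0 jn uA wA AE; rewrite mean_curvature_esymm; congr (_ * _).
rewrite (coef_char_poly_curvatures n0 jn AE) /principal_curvatures.
case: xgetP => [k _ [B [/uA -> BE]]|/(_ kappa)[]]; last by exists A.
exact: coef_char_poly_curvatures.
Qed.

Section C2Plus.
Context {R : realType} {n : nat} (K : set 'rV[R]_n).
Hypotheses (n_ge2 : (2 <= n)%N) (KP : C2_plus K).
Local Notation N := (outer_normal K).

Let cK : convex_body K. Proof. by case: KP. Qed.
Let C2K : C2_boundary K. Proof. by case: KP. Qed.
Let n_gt0 : (0 < n)%N. Proof. by rewrite ltnW. Qed.

(** Without a Weingarten map the curvatures default to 0, and so does their product,
    which is nonempty as n >= 2; but the Gauss curvature is positive. *)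
Lemma principal_curvaturesP x : boundary K x -> exists A : 'M[R]_n,
  is_weingarten K x A /\
  char_poly A = 'X * \prod_(l < n.-1) ('X - (principal_curvatures K x 0 l)%:P).
Proof.
move=> Kx; have [_ _ /(_ x Kx)] := KP; rewrite /gauss_curvature /principal_curvatures.
case: xgetP => [k _ //|_].
have l0 : (0 < n.-1)%N by rewrite -ltnS prednK.
by rewrite (bigD1 (Ordinal l0))//= mxE mul0r ltxx.
Qed.

Definition weingarten_mx x := xget 0 [set A | is_weingarten K x A].

Lemma weingarten_mxP x : boundary K x -> is_weingarten K x (weingarten_mx x).
Proof.
move=> /principal_curvaturesP[A [wA _]]; rewrite /weingarten_mx.
by case: xgetP => [//|/(_ A)].
Qed.

Lemma mean_curvature_coef x j : boundary K x -> (j <= n.-1)%N ->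
  mean_curvature K j x =
  'C(n.-1, j)%:R^-1 * ((-1) ^+ j * (char_poly (weingarten_mx x))`_(n - j)).
Proof.
move=> Kx jn; have [A [wA AE]] := principal_curvaturesP Kx.
rewrite -(weingarten_unique cK C2K Kx wA (weingarten_mxP Kx)).
by rewrite mean_curvature_esymm (coef_char_poly_curvatures n_gt0 jn AE).
Qed.

Lemma mean_curvature_ge0 x j : boundary K x -> 0 <= mean_curvature K j x.
Proof.
move=> Kx; rewrite mean_curvature_esymm mulr_ge0 ?invr_ge0 ?ler0n//.
apply: esymm_ge0 => l; have [A [wA AE]] := principal_curvaturesP Kx.
have /eigenvalueP[v vA v0] : eigenvalue A (principal_curvatures K x 0 l).
  rewrite eigenvalue_root_char AE rootM; apply/orP; right.
  by rewrite (bigD1 l)//= rootM root_XsubC eqxx.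
exact: (weingarten_ge0 cK C2K Kx wA v0 vA).
Qed.

Lemma mean_curvature_continuous j : (j <= n.-1)%N ->
  {within boundary K, continuous (mean_curvature K j)}.
Proof.
move=> jn; apply/subspace_continuousP => x Kx.
have [_ Wx] := weingarten_cvg cK C2K weingarten_mxP Kx.
have E := mean_curvature_coef Kx jn.
have FF : Filter (within (boundary K) (nbhs x)) by exact: within_filter.
have lim := [elaborate cvgM (cvg_cst ('C(n.-1, j)%:R^-1 : R))
  (cvgM (cvg_cst ((-1) ^+ j : R)) (@char_poly_cvg _ _ _ _ _ _ _ Wx (n - j)%N))].
rewrite -E in lim; apply: cvg_trans lim; apply: near_eq_cvg.
have h : \forall y \near x, boundary K y -> 'C(n.-1, j)%:R^-1 *
    ((-1) ^+ j * (char_poly (weingarten_mx y))`_(n - j)) = mean_curvature K j y.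
  exact: (@filterE _ (nbhs x) (nbhs_filter x) _ (fun y Ky => esym (mean_curvature_coef Ky jn))).
exact: h.
Qed.

Lemma support_function_continuous :
  {within boundary K, continuous (fun x => dot x (N x))}.
Proof.
apply/subspace_continuousP => x Kx.
have FF : Filter (within (boundary K) (nbhs x)) by exact: within_filter.
have [Nx _] := weingarten_cvg cK C2K weingarten_mxP Kx.
apply: cvg_dot Nx => i j; apply: cvg_within_filter; exact: coord_continuous.
Qed.

Lemma support_function_ge0 x : K 0 -> boundary K x -> 0 <= dot x (N x).
Proof.
move=> K0 Kx; have := outer_normal_support cK C2K Kx K0.
by rewrite sub0r dotNl oppr_le0.
Qed.

End C2Plus.

(** The integrand as a function of numbers only, the value h of the support function
    and the mean curvatures H j, so that equalities between integrands can be proved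
    without unfolding the curvatures. *)
Definition curvature_density {R : realType} {n : nat} (p : R) (m k : nat)
    (i : 'I_n -> nat) (h : R) (H : nat -> R) : R :=
  H n.-1 `^ (p / (n%:R + p))
     / h `^ (n%:R * (p - 1) / (n%:R + p))
     * h ^ (m%:Z - k%:Z)
     * \prod_(j < n | (1 <= j)%N) ('C(n.-1, j)%:R ^+ i j * H j ^+ i j).

Lemma eq_curvature_density {R : realType} {n : nat} (p : R) (m k : nat)
    (i : 'I_n -> nat) (h : R) (H H' : nat -> R) : (0 < n)%N ->
  (forall j, (j <= n.-1)%N -> H j = H' j) ->
  curvature_density p m k i h H = curvature_density p m k i h H'.
Proof.
move=> n0 HH; rewrite /curvature_density HH//; congr (_ * _).
by apply: eq_bigr => j _; rewrite HH// -ltnS prednK.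
Qed.

(** The integrand of [affine_surface_area], to which it is convertible. *)
Definition affine_density (R : realType) (n : nat) (p : R) (m k : nat)
    (i : 'I_n -> nat) (K : set 'rV[R]_n) (x : 'rV[R]_n) : R :=
  curvature_density p m k i (dot x (outer_normal K x)) (fun j => mean_curvature K j x).

Section Density.
Context {R : realType} {n : nat} (n_ge2 : (2 <= n)%N) (p : R) (m k : nat) (i : 'I_n -> nat).
Context (K : set 'rV[R]_n) (KC : C2_plus_centered K).

Lemma C2_plus_centered_mem0 : K 0.
Proof. by case: KC => -[cK _ _]; exact: centroid0_mem. Qed.

Lemma affine_density_ge0 x : boundary K x -> 0 <= affine_density p m k i K x.
Proof.
move=> Kx; have [KP _] := KC.
have h0 := support_function_ge0 KP C2_plus_centered_mem0 Kx.
rewrite /affine_density /curvature_density !mulr_ge0 ?invr_ge0 ?powR_ge0//.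
  by case: (_ - _ : int) => z; rewrite ?invr_ge0 exprn_ge0.
apply: prodr_ge0 => j _; rewrite mulr_ge0 ?exprn_ge0 ?ler0n//.
exact: mean_curvature_ge0.
Qed.

(** The inverse is measurable on nonnegative numbers as the power of exponent -1. *)
Lemma affine_density_measurable (mu : {outer_measure set 'rV[R]_n -> \bar R}) :
  (forall U, open U -> mu.-caratheodory U) ->
  measurable_fun (boundary K : set (caratheodory_type mu)) (affine_density p m k i K).
Proof.
move=> muo; have [KP _] := KC.
have mH j : (j <= n.-1)%N ->
    measurable_fun (boundary K : set (caratheodory_type mu)) (mean_curvature K j).
  move=> jn; apply: continuous_caratheodory_measurable muo _.
  exact: mean_curvature_continuous.
pose h x := dot x (outer_normal K x).
have mh : measurable_fun (boundary K : set (caratheodory_type mu)) h.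
  apply: continuous_caratheodory_measurable muo _.
  exact: support_function_continuous.
have h0 x : boundary K x -> 0 <= h x by exact: (support_function_ge0 KP C2_plus_centered_mem0).
have minv (f : 'rV[R]_n -> R) : (forall x, boundary K x -> 0 <= f x) ->
    measurable_fun (boundary K : set (caratheodory_type mu)) f ->
    measurable_fun (boundary K : set (caratheodory_type mu)) (fun x => (f x)^-1).
  move=> f0 mf; apply: (@eq_measurable_fun _ _ (caratheodory_type mu) (R : measurableType _) _
    (fun x => f x `^ (-1))).
    by move=> x /[!inE] Kx; rewrite powR_inv1// f0.
  exact: (measurableT_comp (measurable_powR (-1))).
rewrite /affine_density /curvature_density.
apply: measurable_funM; [apply: measurable_funM; [apply: measurable_funM|]|].
- by apply: (measurableT_comp (measurable_powR _)); exact: mH.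
- apply: minv => [x _|]; first exact: powR_ge0.
  by apply: (measurableT_comp (measurable_powR _)).
- case: (_ - _ : int) => z; first exact: measurable_funX.
  by apply: minv => [x Kx|]; [rewrite exprn_ge0// h0|exact: measurable_funX].
- under eq_fun do rewrite -big_filter.
  apply: measurable_prod => j _; apply: measurable_funM; first exact: measurable_cst.
  by apply: measurable_funX; apply: mH; rewrite -ltnS prednK// ltnW.
Qed.

End Density.

(** * Behaviour under similarities *)

Lemma mxcvg_cvg {R : realType} {T : Type} (F : set_system T) {FF : Filter F} n
    (f : T -> 'rV[R]_n) a : mxcvg F f a -> f t @[t --> F] --> a.
Proof.
move=> fa; apply/cvgrPdist_le => e e0.
have h : \forall t \near F, forall j : 'I_n, `|f t 0 j - a 0 j| <= e.
  apply: (@filter_forall _ _ (fun j t => `|f t 0 j - a 0 j| <= e) F _) => j.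
  have /cvgrPdist_le/(_ e e0) := fa 0 j.
  by apply: filterS => t; rewrite distrC.
apply: filterS h => t h; rewrite distrC; apply: norm_rV_le; first exact: ltW.
by move=> j; rewrite !mxE.
Qed.

Lemma homeomorphism_boundary {R : realType} {n : nat} (f h : 'rV[R]_n -> 'rV[R]_n)
    (K : set 'rV[R]_n) : cancel f h -> cancel h f -> continuous f -> continuous h ->
  boundary (f @` K) = f @` boundary K.
Proof.
move=> fK hK cf ch.
have imE (A : set 'rV[R]_n) : f @` A = h @^-1` A.
  by apply/seteqP; split => [_ [x Ax <-]|y Ay]; [rewrite /= fK|exists (h y)].
have intE (A : set 'rV[R]_n) : (h @^-1` A)° = h @^-1` A°.
  apply/seteqP; split => y; last by rewrite /interior/= => /ch.
  rewrite /interior/= => hy; have := cf (h y); rewrite /continuous_at hK => /(_ _ hy).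
  by rewrite nbhs_simpl/=; apply: filterS => z /=; rewrite fK.
rewrite !imE /boundary; have -> : closure (h @^-1` K) = h @^-1` closure K.
  by rewrite -[LHS]setCK -interiorC preimage_setC intE interiorC -preimage_setC setCK.
by rewrite intE.
Qed.

Section Similarity.
Context {R : realType} {n : nat}.
Implicit Types (a : R) (Q : 'M[R]_n) (x y u v : 'rV[R]_n) (K : set 'rV[R]_n).

Definition similarity a Q x : 'rV[R]_n := a *: (x *m Q).

Lemma similarityK a Q : a != 0 -> Q *m Q^T = 1%:M ->
  cancel (similarity a Q) (similarity a^-1 Q^T).
Proof.
move=> a0 QQ x; rewrite /similarity -scalemxAl scalerA mulVf// scale1r.
by rewrite -mulmxA QQ mulmx1.
Qed.

Lemma similarityB a Q x y : similarity a Q x - similarity a Q y = a *: ((x - y) *m Q).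
Proof. by rewrite mulmxBl scalerBr. Qed.

Lemma dot_orthogonal Q u v : Q *m Q^T = 1%:M -> dot (u *m Q) (v *m Q) = dot u v.
Proof. by move=> QQ; rewrite dot_mulmxl -mulmxA QQ mulmx1. Qed.

Lemma enorm_similarity a Q x y : 0 <= a -> Q *m Q^T = 1%:M ->
  enorm (similarity a Q x - similarity a Q y) = a * enorm (x - y).
Proof.
move=> a0 QQ; rewrite similarityB enormZ ger0_norm//; congr (_ * _).
by rewrite /enorm dot_orthogonal.
Qed.

Lemma continuous_similarity a Q : continuous (similarity a Q).
Proof.
move=> x; apply: (@mxcvg_cvg _ _ (nbhs x)).
apply: mxcvgZ; first exact: cvg_cst.
by apply: mxcvgM; [move=> i j; exact: coord_continuous|exact: mxcvg_cst].
Qed.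

Lemma norm_mulmx_le Q : exists2 C : R, 0 < C & forall u, `|u *m Q| <= C * `|u|.
Proof.
pose C := 1 + \sum_(j < n) n%:R * `|(row j Q^T : 'rV[R]_n)|.
have C0 : 0 < C by rewrite ltr_wpDr// sumr_ge0.
exists C => // u; apply: norm_rV_le => [|j]; first by apply: mulr_ge0 => //; exact: ltW.
have -> : (u *m Q) 0 j = dot u (row j Q^T).
  by rewrite mxE; apply: eq_bigr => l _; rewrite !mxE.
apply: le_trans (norm_dot_le _ _) _; rewrite mulrAC ler_wpM2r//.
by rewrite /C (bigD1 j)//= addrCA lerDl addr_ge0// sumr_ge0.
Qed.

End Similarity.

Section SimilarityTransfer.
Context {R : realType} {n : nat} (a : R) (Q : 'M[R]_n).
Hypotheses (a_gt0 : 0 < a) (QQ : Q *m Q^T = 1%:M).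
Implicit Types (K : set 'rV[R]_n) (x y u v : 'rV[R]_n).
Local Notation T := (similarity a Q).
Local Notation T' := (similarity a^-1 Q^T).

Let QQ' : Q^T *m Q = 1%:M. Proof. exact: mulmx1C. Qed.
Let a_neq0 : a != 0. Proof. by rewrite gt_eqF. Qed.
Let TK : cancel T T'. Proof. exact: similarityK. Qed.
Let TK' : cancel T' T.
Proof.
have := @similarityK R n a^-1 Q^T; rewrite trmxK invrK; apply; last by [].
by rewrite invr_eq0.
Qed.

Lemma boundary_similarity K : boundary (T @` K) = T @` boundary K.
Proof.
by apply: (@homeomorphism_boundary _ _ _ T') => //; exact: continuous_similarity.
Qed.

(** A vector u supports the image if and only if u Q^T supports K. *)
Lemma outer_normal_similarity K x : convex_body K -> C2_boundary K -> boundary K x ->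
  outer_normal (T @` K) (T x) = outer_normal K x *m Q.
Proof.
move=> cK C2K Kx.
have nP u : (enorm u = 1 /\ forall y, (T @` K) y -> dot (y - T x) u <= 0) <->
    u = outer_normal K x *m Q.
  have -> : (u = outer_normal K x *m Q) <-> (u *m Q^T = outer_normal K x).
    by split => [->|<-]; rewrite -mulmxA ?QQ ?QQ' mulmx1.
  rewrite -(is_normalE cK C2K _ Kx).
  have eu : enorm (u *m Q^T) = enorm u.
    by rewrite /enorm dot_orthogonal// trmxK.
  have du y : dot (T y - T x) u = a * dot (y - x) (u *m Q^T).
    by rewrite similarityB dotZl dot_mulmxl.
  rewrite eu; split => -[u1 uK]; split => // y.
    move=> Ky; have /uK : (T @` K) (T y) by exists y.
    by rewrite du pmulr_rle0.
  by move=> [z Kz <-]; rewrite du pmulr_rle0// uK.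
rewrite {1}/outer_normal; case: xgetP => [u _ /nP//|/(_ (outer_normal K x *m Q))[]].
exact/nP.
Qed.

End SimilarityTransfer.

Section WeingartenTransfer.
Context {R : realType} {n : nat} (a : R) (Q : 'M[R]_n).
Hypotheses (a_gt0 : 0 < a) (QQ : Q *m Q^T = 1%:M).

Lemma weingarten_similarity (K K' : set 'rV[R]_n) (x : 'rV[R]_n) (A : 'M[R]_n) :
  boundary K' = similarity a Q @` boundary K ->
  (forall y, boundary K y -> outer_normal K' (similarity a Q y) = outer_normal K y *m Q) ->
  boundary K x -> is_weingarten K x A ->
  is_weingarten K' (similarity a Q x) (a^-1 *: (Q^T *m A *m Q)).
Proof.
move=> KK' NN Kx [NA dA].
have a0 : a != 0 by rewrite gt_eqF.
split.
  rewrite NN// -scalemxAr !mulmxA -(mulmxA _ Q) QQ mulmx1 NA mul0mx scaler0.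
  by [].
move=> e e0.
have [C C0 CQ] := norm_mulmx_le Q; have [D D0 DQ] := norm_mulmx_le Q^T.
have e1 : 0 < e / (C * (a^-1 * D)) by rewrite divr_gt0// !mulr_gt0// invr_gt0.
have near_x := dA _ e1.
have TK := @similarityK R n a Q a0 QQ.
have cT' := @continuous_similarity R n a^-1 Q^T (similarity a Q x).
rewrite /continuous_at TK in cT'.
have near_Tx : \forall y \near similarity a Q x, boundary K (similarity a^-1 Q^T y) ->
    `|outer_normal K (similarity a^-1 Q^T y) - outer_normal K x -
      (similarity a^-1 Q^T y - x) *m A| <=
    e / (C * (a^-1 * D)) * `|similarity a^-1 Q^T y - x|.
  exact: cT' near_x.
have : \forall y \near similarity a Q x, boundary K' y ->
    `|outer_normal K' y - outer_normal K' (similarity a Q x) -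
      (y - similarity a Q x) *m (a^-1 *: (Q^T *m A *m Q))| <= e * `|y - similarity a Q x|.
  apply: filterS near_Tx => y' h; rewrite KK' => -[y Ky yy']; move: h.
  rewrite -yy' TK => /(_ Ky) h; rewrite !NN// similarityB.
  have -> : outer_normal K y *m Q - outer_normal K x *m Q -
      a *: ((y - x) *m Q) *m (a^-1 *: (Q^T *m A *m Q)) =
      (outer_normal K y - outer_normal K x - (y - x) *m A) *m Q.
    rewrite -scalemxAr -scalemxAl scalerA mulVf// scale1r !mulmxA.
    by rewrite -(mulmxA _ Q) QQ mulmx1 !mulmxBl.
  apply: le_trans (CQ _) _.
  apply: (@le_trans _ _ (C * (e / (C * (a^-1 * D)) * (a^-1 * (D * `|a *: ((y - x) *m Q)|))))).
    rewrite ler_wpM2l ?(ltW C0)//; apply: le_trans h _; rewrite ler_wpM2l ?(ltW e1)//.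
    have yx : y - x = a^-1 *: ((a *: ((y - x) *m Q)) *m Q^T).
      by rewrite -scalemxAl scalerA mulVf// scale1r -mulmxA QQ mulmx1.
    rewrite [X in `|X| <= _]yx normrZ gtr0_norm ?invr_gt0// ler_wpM2l ?invr_ge0 ?(ltW a_gt0)//.
  rewrite le_eqVlt; apply/orP; left; apply/eqP; field.
  by rewrite a0 !gt_eqF.
exact.
Qed.

End WeingartenTransfer.

Section AreaSimilarity.
Context {R : realType} {n : nat} (a : R) (Q : 'M[R]_n).
Hypotheses (n_ge2 : (2 <= n)%N) (a_gt0 : 0 < a) (QQ : Q *m Q^T = 1%:M).
Implicit Types (K : set 'rV[R]_n) (x : 'rV[R]_n).
Local Notation T := (similarity a Q).
Local Notation T' := (similarity a^-1 Q^T).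

Let QQ' : Q^T *m Q = 1%:M. Proof. exact: mulmx1C. Qed.
Let a_neq0 : a != 0. Proof. by rewrite gt_eqF. Qed.
Let TK : cancel T T'. Proof. exact: similarityK. Qed.
Let TK' : cancel T' T.
Proof.
have := @similarityK R n a^-1 Q^T; rewrite trmxK invrK; apply; last by [].
by rewrite invr_eq0.
Qed.
Let n_gt0 : (0 < n)%N. Proof. by rewrite ltnW. Qed.

Lemma weingarten_similarity_inv K x (B : 'M[R]_n) :
  convex_body K -> C2_boundary K -> boundary K x ->
  is_weingarten (T @` K) (T x) B -> is_weingarten K x (a *: (Q *m B *m Q^T)).
Proof.
move=> cK C2K Kx wB.
have av0 : 0 < a^-1 by rewrite invr_gt0.
have QQt : Q^T *m Q^T^T = 1%:M by rewrite trmxK.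
have := @weingarten_similarity _ _ _ _ av0 QQt (T @` K) K (T x) B.
rewrite invrK trmxK TK; apply => //.
- rewrite (boundary_similarity a_gt0 QQ) image_comp; apply/seteqP; split => [y Ky|_ [y Ky <-]].
    by exists y => //=; rewrite TK.
  by rewrite /= TK.
- move=> y; rewrite (boundary_similarity a_gt0 QQ) => -[z Kz <-].
  by rewrite TK (outer_normal_similarity a_gt0 QQ cK C2K Kz) -mulmxA QQ mulmx1.
- by rewrite (boundary_similarity a_gt0 QQ); exists x.
Qed.

Lemma mean_curvature_similarity K x j : C2_plus K -> boundary K x -> (j <= n.-1)%N ->
  mean_curvature (T @` K) j (T x) = a^-1 ^+ j * mean_curvature K j x.
Proof.
move=> KP Kx jn; have [cK C2K _] := KP.
have [A [wA AE]] := principal_curvaturesP n_ge2 KP Kx.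
rewrite (@mean_curvature_eq _ _ _ _ (a^-1 *: (Q^T *m A *m Q))
    (a^-1 *: principal_curvatures K x))//.
- by rewrite esymm_scale mulrCA.
- move=> B /(weingarten_similarity_inv cK C2K Kx) wB.
  rewrite -(weingarten_unique cK C2K Kx wB wA) -scalemxAr -scalemxAl scalerA mulVf// scale1r.
  by rewrite !mulmxA QQ' mul1mx -mulmxA QQ' mulmx1.
- apply: (weingarten_similarity a_gt0 QQ _ _ Kx wA); first exact: boundary_similarity.
  by move=> y; exact: outer_normal_similarity.
- rewrite char_poly_scale_conj ?invr_eq0// invrK AE rmorphM /= comp_polyX rmorph_prod/=.
  rewrite -{1}(prednK n_gt0) exprS -scalerA scalerAr scalerAl.
  rewrite scalerA mulVf// scale1r; congr (_ * _).
  rewrite -[in (_ ^+ _)](card_ord n.-1) -prodr_const -scaler_prod/=.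
  apply: eq_bigr => l _.
  by rewrite rmorphB/= comp_polyX comp_polyC mxE scalerBr scalerA mulVf// scale1r polyCM mul_polyC.
Qed.

(** Each factor is multiplied by a power of a: the power of H_(n-1) contributes
    -(n-1) p/(n+p), the two powers of the support function -n(p-1)/(n+p) and m - k,
    and the product of mean curvatures -m. *)
Lemma affine_density_similarity K x (p : R) (m k : nat) (i : 'I_n -> nat) :
  p <> - n%:R -> (\sum_(j < n | (1 <= j)%N) j * i j = m)%N ->
  C2_plus_centered K -> boundary K x ->
  affine_density p m k i (T @` K) (T x) =
  a `^ (n%:R * ((n%:R - p) / (n%:R + p)) - k%:R - n.-1%:R) * affine_density p m k i K x.
Proof.
move=> pn im KC Kx; have [KP _] := KC; have [cK C2K _] := KP.
have np0 : n%:R + p != 0 by apply/eqP => h; apply: pn; apply/eqP; rewrite -addr_eq0 addrC h.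
rewrite /affine_density /curvature_density mean_curvature_similarity//.
rewrite (outer_normal_similarity a_gt0 QQ cK C2K Kx) /similarity dotZl dot_orthogonal//.
set h := dot x _; set H := mean_curvature K n.-1 x.
have h0 : 0 <= h := support_function_ge0 KP (C2_plus_centered_mem0 KC) Kx.
have H0 : 0 <= H := mean_curvature_ge0 n_ge2 KP n.-1 Kx.
have prodE : \prod_(j < n | (1 <= j)%N)
      ('C(n.-1, j)%:R ^+ i j * mean_curvature (T @` K) j (T x) ^+ i j) =
    a `^ (- m%:R) * \prod_(j < n | (1 <= j)%N)
      ('C(n.-1, j)%:R ^+ i j * mean_curvature K j x ^+ i j).
  rewrite powR_invn ?(ltW a_gt0)// -exprVn -im -prodrXr -big_split/=.
  apply: eq_bigr => j _; rewrite mean_curvature_similarity//.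
    by rewrite exprMn -exprM mulrCA.
  by rewrite -ltnS prednK.
rewrite [X in _ * X = _]prodE.
clearbody h H.
rewrite exprVn -powR_invn ?(ltW a_gt0)// !powRM ?powR_ge0 ?(ltW a_gt0)// -powRrM.
rewrite expfzMl -[a ^ _](powR_intmul _ (ltW a_gt0)) invfM -!powRN.
set e1 := - n.-1%:R * _; set e2 := - (_ / _); set e3 := _%:~R.
have -> : n%:R * ((n%:R - p) / (n%:R + p)) - k%:R - n.-1%:R = e1 + e2 + e3 + - m%:R.
  rewrite /e1 /e2 /e3 rmorphB/= -!pmulrn -[n in n%:R](prednK n_gt0) -natr1.
  rewrite -[n in n%:R](prednK n_gt0) -natr1 in np0.
  by field.
rewrite !powRD ?a_neq0 ?implybT//; ring.
Qed.

Lemma affine_surface_area_similarity K (p : R) (m k : nat) (i : 'I_n -> nat) :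
  p <> - n%:R -> (\sum_(j < n | (1 <= j)%N) j * i j = m)%N -> C2_plus_centered K ->
  affine_surface_area p m k i (T @` K) =
  ((a `^ (n%:R * ((n%:R - p) / (n%:R + p)) - k%:R))%:E * affine_surface_area p m k i K)%E.
Proof.
move=> pn im KC; have [[cK C2K _] _] := KC.
set e := _ - k%:R; pose c := a `^ (e - n.-1%:R).
have mbd : (@hausdorff_outer R n n.-1).-caratheodory (boundary K).
  rewrite /boundary; apply: caratheodory_measurable_setD.
    rewrite -[closure K]setCK; apply: caratheodory_measurable_setC.
    by apply: open_hausdorff_measurable; apply: closed_openC; exact: closed_closure.
  by apply: open_hausdorff_measurable; exact: open_interior.
have mdens := affine_density_measurable n_ge2 p m k i KC (@open_hausdorff_measurable R n n.-1).
rewrite /affine_surface_area (boundary_similarity a_gt0 QQ).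
transitivity (\int[hausdorff_measure R n n.-1]_(y in T @` boundary K)
    ((c%:E * (affine_density p m k i K (T' y))%:E)))%E.
  apply: eq_integral => y; rewrite inE => -[x Kx <-].
  by rewrite TK -EFinM -(affine_density_similarity k pn im KC Kx).
have simT x y : enorm (T x - T y) = a * enorm (x - y).
  exact: enorm_similarity (ltW a_gt0) QQ.
have c0 : 0 <= c := powR_ge0 _ _.
have f0 x : boundary K x -> (0 <= (affine_density p m k i K x)%:E)%E.
  by move=> Kx; rewrite lee_fin; exact: affine_density_ge0.
have cf0 x : boundary K x -> (0 <= c%:E * (affine_density p m k i K x)%:E)%E.
  by move=> /f0; apply: mule_ge0; rewrite lee_fin.
have mf : measurable_fun (boundary K : set (caratheodory_type (@hausdorff_outer R n n.-1)))
  (fun x => (affine_density p m k i K x)%:E) by exact/measurable_EFinP.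
have mcf := measurable_funeM c%:E mf.
apply: (etrans (integral_similarity a_gt0 simT TK TK' mbd mcf cf0)).
have scale := ge0_integralZl_EFin (hausdorff_measure R n n.-1) mbd f0 mf c0.
apply: (etrans (congr1 (fun z => (a ^+ n.-1)%:E * z)%E scale)).
rewrite muleA -EFinM; congr (_%:E * _)%E.
rewrite -powR_mulrn ?(ltW a_gt0)// -powRD ?a_neq0 ?implybT//.
by rewrite addrC subrK.
Qed.

End AreaSimilarity.

(** * Valuation *)

Section LocalDensity.
Context {R : realType} {n : nat}.
Implicit Types (K M U : set 'rV[R]_n) (x y u : 'rV[R]_n).

Lemma local_boundary K M U x : convex_body K -> convex_body M -> open U ->
  K `&` U = M `&` U -> U x -> boundary K x -> boundary M x.
Proof.
move=> cK cM oU KMU Ux; rewrite !boundary_convex_body// => -[Kx nK].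
have KM y : U y -> (K y <-> M y).
  move=> Uy; split => h; first by have : (K `&` U) y by []; rewrite KMU => -[].
  by have : (M `&` U) y by []; rewrite -KMU => -[].
split; first exact/KM.
move=> Mx; apply: nK; move: Mx; rewrite /interior/= => Mx.
have MU := [elaborate filterI Mx (open_nbhs_nbhs (conj oU Ux))].
apply: filterS MU => y [My Uy].
by have : (M `&` U) y by []; rewrite -KMU => -[].
Qed.

(** By convexity a point of M can be pulled towards x into the open set where the two
    bodies agree. *)
Lemma local_normal K M U x u : convex_body K -> convex_body M -> open U ->
  K `&` U = M `&` U -> U x -> K x ->
  (forall y, K y -> dot (y - x) u <= 0) -> forall y, M y -> dot (y - x) u <= 0.
Proof.
move=> cK cM oU KMU Ux Kx uK y My.
have Mx : M x by have : (K `&` U) x by []; rewrite KMU => -[].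
have /nbhs_ballP[r /= r0 rU] := open_nbhs_nbhs (conj oU Ux).
(* short enough a pull to land in the ball of radius r, also when y = x *)
pose t := r / (r + `|y - x|).
have d0 : 0 < r + `|y - x| by rewrite ltr_pwDl.
have t0 : 0 < t by rewrite divr_gt0.
have t1 : t <= 1 by rewrite ler_pdivrMr// mul1r lerDl.
have zx : t *: y + (1 - t) *: x = x + t *: (y - x).
  by apply/rowP => i; rewrite !mxE; ring.
have Mz : M (x + t *: (y - x)).
  by rewrite -zx; apply: (convex_bodyP cM); rewrite ?(ltW t0).
have [->|yx] := eqVneq y x; first by rewrite subrr dot0l.
have Uz : U (x + t *: (y - x)).
  apply: rU; rewrite -ball_normE/= opprD addrA subrr sub0r normrN normrZ gtr0_norm//.
  rewrite /t mulrAC ltr_pdivrMr// ltr_pM2l// ltrDr.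
  by [].
have : (M `&` U) (x + t *: (y - x)) by [].
rewrite -KMU => -[/uK + _]; by rewrite addrC addKr dotZl pmulr_rle0.
Qed.

Lemma local_outer_normal K M U x : convex_body K -> convex_body M -> open U ->
  K `&` U = M `&` U -> U x -> boundary K x -> outer_normal K x = outer_normal M x.
Proof.
move=> cK cM oU KMU Ux Kbx; have Kx := boundary_mem cK Kbx.
have Mx : M x by have : (K `&` U) x by []; rewrite KMU => -[].
rewrite /outer_normal; congr xget; apply/seteqP; split => u /= [u1 uK]; split => //.
  exact: (local_normal cK cM oU KMU).
exact: (local_normal cM cK oU (esym KMU)).
Qed.

Lemma local_weingarten K M U x A : convex_body K -> convex_body M -> open U ->
  K `&` U = M `&` U -> U x -> boundary K x -> is_weingarten K x A -> is_weingarten M x A.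
Proof.
move=> cK cM oU KMU Ux Kx [NA dA]; have N := local_outer_normal cK cM oU KMU.
split; first by rewrite -N.
move=> e e0.
have near_x : nbhs x [set y | boundary K y ->
  `|outer_normal K y - outer_normal K x - (y - x) *m A| <= e * `|y - x|] := dA e e0.
have near_U := open_nbhs_nbhs (conj oU Ux).
have : \forall y \near x, boundary M y ->
  `|outer_normal M y - outer_normal M x - (y - x) *m A| <= e * `|y - x|.
  have near_xU := [elaborate filterI near_x near_U].
  apply: filterS near_xU => y [h Uy] My.
  have Ky : boundary K y by exact: (local_boundary cM cK oU (esym KMU)).
  by rewrite -!N//; exact: h.
exact.
Qed.

Lemma local_affine_density K M U x (p : R) (m k : nat) (i : 'I_n -> nat) :
  convex_body K -> convex_body M -> open U ->
  K `&` U = M `&` U -> U x -> boundary K x ->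
  affine_density p m k i K x = affine_density p m k i M x.
Proof.
move=> cK cM oU KMU Ux Kx.
have Mx : boundary M x by exact: (local_boundary cK cM oU KMU).
have pc : principal_curvatures K x = principal_curvatures M x.
  rewrite /principal_curvatures; congr xget; apply/seteqP; split => kap /= [A [wA AE]];
    exists A; split => //.
    exact: (local_weingarten cK cM oU KMU Ux Kx wA).
  exact: (local_weingarten cM cK oU (esym KMU) Ux Mx wA).
rewrite /affine_density (local_outer_normal cK cM oU KMU Ux Kx).
suff -> : (fun j => mean_curvature K j x) = (fun j => mean_curvature M j x) by [].
by apply/funext => j; rewrite !mean_curvature_esymm pc.
Qed.

(** A normal of the larger body supports the smaller one, whose normal is unique. *)
Lemma outer_normal_subset K M x : convex_body K -> C2_boundary K ->
  convex_body M -> C2_boundary M -> K `<=` M ->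
  boundary K x -> boundary M x -> outer_normal M x = outer_normal K x.
Proof.
move=> cK C2K cM C2M KM Kx Mx; apply/(is_normalE cK C2K _ Kx); split.
  exact: enorm_outer_normal.
by move=> y /KM; exact: outer_normal_support.
Qed.

Lemma affine_density_weingarten K M x A (p : R) (m k : nat) (i : 'I_n -> nat) :
  (2 <= n)%N -> C2_plus K -> C2_plus M -> boundary K x -> boundary M x ->
  outer_normal K x = outer_normal M x ->
  is_weingarten K x A -> is_weingarten M x A ->
  affine_density p m k i K x = affine_density p m k i M x.
Proof.
move=> n2 KP MP Kx Mx NE wK wM; have [cK C2K _] := KP; have [cM C2M _] := MP.
have mc j : (j <= n.-1)%N -> mean_curvature K j x = mean_curvature M j x.
  move=> jn; have EK := mean_curvature_coef n2 KP Kx jn.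
  have EM := mean_curvature_coef n2 MP Mx jn.
  rewrite -(weingarten_unique cK C2K Kx wK (weingarten_mxP n2 KP Kx)) in EK.
  rewrite -(weingarten_unique cM C2M Mx wM (weingarten_mxP n2 MP Mx)) in EM.
  by rewrite EK EM.
rewrite /affine_density NE.
by apply: eq_curvature_density mc; exact: ltnW.
Qed.

End LocalDensity.

Lemma eq_pairs_of_mem (T : Type) (a b c d : T) :
  a = c \/ a = d -> b = c \/ b = d -> c = a \/ c = b -> d = a \/ d = b ->
  (a = c /\ b = d) \/ (a = d /\ b = c).
Proof.
move=> [->|->] hb [h|h] [h'|h'].
- by left; split => //; case: hb => ->.
- by left.
- by left; split => //; case: hb => ->.
- by left.
- by right; split => //; case: hb => ->.
- by right; split => //; case: hb => ->.
- by right.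
- by right.
Qed.

Lemma ereal_sum_regroup (R : realType) (ek el fk fl du di dk dl U I K L : \bar R) :
  (U = ek + el + du -> I = fk + fl + di -> K = ek + fk + dk -> L = el + fl + dl ->
   du + di = dk + dl -> U + I = K + L)%E.
Proof.
move=> -> -> -> -> d; rewrite addeACA d [RHS]addeACA; congr (_ + _)%E.
by rewrite addeACA.
Qed.

Section Valuation.
Context {R : realType} {n : nat} (n_ge2 : (2 <= n)%N) (p : R) (m k : nat) (i : 'I_n -> nat).
Context (K L : set 'rV[R]_n).
Hypotheses (KC : C2_plus_centered K) (LC : C2_plus_centered L)
  (UC : C2_plus_centered (K `|` L)) (IC : C2_plus_centered (K `&` L)).
Local Notation bd := (@boundary R n).
Local Notation mu := (hausdorff_measure R n n.-1).
Local Notation f := (affine_density p m k i).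

Let cK : convex_body K. Proof. by case: KC => -[]. Qed.
Let cL : convex_body L. Proof. by case: LC => -[]. Qed.
Let cU : convex_body (K `|` L). Proof. by case: UC => -[]. Qed.
Let cI : convex_body (K `&` L). Proof. by case: IC => -[]. Qed.
Let C2K : C2_boundary K. Proof. by case: KC => -[]. Qed.
Let C2L : C2_boundary L. Proof. by case: LC => -[]. Qed.
Let C2U : C2_boundary (K `|` L). Proof. by case: UC => -[]. Qed.
Let C2I : C2_boundary (K `&` L). Proof. by case: IC => -[]. Qed.

(** The normals of K and L support the intersection, so both are its normal there and
    they coincide.  This common normal supports the union, whence x is not interior
    to it. *)
Lemma boundary_contact x : bd K x -> bd L x ->
  [/\ bd (K `|` L) x, bd (K `&` L) x,
      outer_normal (K `|` L) x = outer_normal K x,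
      outer_normal (K `&` L) x = outer_normal K x &
      outer_normal L x = outer_normal K x].
Proof.
move=> Kx Lx; have KxK := boundary_mem cK Kx; have LxL := boundary_mem cL Lx.
have Ix : bd (K `&` L) x.
  rewrite boundary_convex_body//; split; first by [].
  by rewrite interiorI => -[/(boundary_not_interior cK Kx)].
have NI : outer_normal K x = outer_normal (K `&` L) x.
  by apply: outer_normal_subset => //; exact: subIsetl.
have NI' : outer_normal L x = outer_normal (K `&` L) x.
  by apply: outer_normal_subset => //; exact: subIsetr.
have Ux : bd (K `|` L) x.
  rewrite boundary_convex_body//; split; first by left.
  rewrite /interior/= => /nbhs_ballP[r /= r0 rKL].
  set u := outer_normal K x.
  have u1 : dot u u = 1 by exact: dot_outer_normal.
  have un0 : 0 < `|u|.
    rewrite normr_gt0; apply/eqP => u0; move: u1; rewrite u0 dot0l => /esym/eqP.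
    by rewrite oner_eq0.
  (* if x is interior to the union, so is a point slightly outwards along the normal *)
  pose t := r / (2 * `|u|); have t0 : 0 < t by rewrite divr_gt0// mulr_gt0.
  have /rKL : ball x r (x + t *: u).
    rewrite -ball_normE/= opprD addrA subrr sub0r normrN normrZ gtr0_norm//.
    have -> : t * `|u| = r / 2 by rewrite /t; field; rewrite gt_eqF.
    lra.
  have key : dot (x + t *: u - x) u = t by rewrite addrC addKr dotZl u1 mulr1.
  case => [Kz|Lz].
    by have := outer_normal_support cK C2K Kx Kz; rewrite key leNgt t0.
  by have := outer_normal_support cL C2L Lx Lz; rewrite NI' -NI key leNgt t0.
split => //; last by rewrite NI'.
by apply: outer_normal_subset => //; exact: subsetUl.
Qed.

(** By [weingarten_contact], applied to each of the four bodies with respect to two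
    others, the pair of Weingarten maps of the union and the intersection is the pair
    of those of K and L up to order. *)
Lemma affine_density_contact x : bd K x -> bd L x ->
  f (K `|` L) x + f (K `&` L) x = f K x + f L x.
Proof.
move=> Kx Lx; have [Ux Ix NU NI NL] := boundary_contact Kx Lx.
have [[[KP _] [LP _]] [[UP _] [IP _]]] := (KC, LC, (UC, IC)).
have wK := weingarten_mxP n_ge2 KP Kx; have wL := weingarten_mxP n_ge2 LP Lx.
have wU := weingarten_mxP n_ge2 UP Ux; have wI := weingarten_mxP n_ge2 IP Ix.
have nUK y : bd (K `|` L) y -> bd K y -> outer_normal (K `|` L) y = outer_normal K y.
  by move=> *; apply: outer_normal_subset => //; exact: subsetUl.
have nUL y : bd (K `|` L) y -> bd L y -> outer_normal (K `|` L) y = outer_normal L y.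
  by move=> *; apply: outer_normal_subset => //; exact: subsetUr.
have nIK y : bd (K `&` L) y -> bd K y -> outer_normal (K `&` L) y = outer_normal K y.
  by move=> *; apply/esym; apply: outer_normal_subset => //; exact: subIsetl.
have nIL y : bd (K `&` L) y -> bd L y -> outer_normal (K `&` L) y = outer_normal L y.
  by move=> *; apply/esym; apply: outer_normal_subset => //; exact: subIsetr.
have bU : bd (K `|` L) `<=` bd K `|` bd L.
  rewrite !boundary_convex_body// => y [[Ky|Ly] nU]; [left|right]; split => // h;
    apply: nU; apply: interiorS h; [exact: subsetUl|exact: subsetUr].
have bI : bd (K `&` L) `<=` bd K `|` bd L.
  rewrite !boundary_convex_body// interiorI => y [[Ky Ly] nI].
  have [Kiy|] := pselect (K° y); last by left.
  by right; split => // Liy; apply: nI.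
have b1 (A B : set 'rV[R]_n) : convex_body A -> convex_body B -> convex_body (A `|` B) ->
    convex_body (A `&` B) -> bd A `<=` bd (A `|` B) `|` bd (A `&` B).
  move=> cA cB cAB cAI y Ay; have Ayy := boundary_mem cA Ay.
  have [By|nBy] := pselect (B y).
    right; rewrite boundary_convex_body//; split => //.
    by rewrite interiorI => -[/(boundary_not_interior cA Ay)].
  left; apply: (@local_boundary _ _ A _ (~` B)) => //.
    by apply: closed_openC; exact: convex_body_closed.
  by rewrite setIUl setICr setU0.
have bL : bd L `<=` bd (K `|` L) `|` bd (K `&` L).
  rewrite (setUC K L) (setIC K L); apply: b1 => //; first by rewrite (setUC L K).
  by rewrite (setIC L K).
have eU := weingarten_contact cU C2U Ux bU nUK nUL Kx Lx wU wK wL.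
have eI := weingarten_contact cI C2I Ix bI nIK nIL Kx Lx wI wK wL.
have eK := weingarten_contact cK C2K Kx (b1 _ _ cK cL cU cI)
  (fun y Ky Uy => esym (nUK y Uy Ky)) (fun y Ky Iy => esym (nIK y Iy Ky)) Ux Ix wK wU wI.
have eL := weingarten_contact cL C2L Lx bL
  (fun y Ly Uy => esym (nUL y Uy Ly)) (fun y Ly Iy => esym (nIL y Iy Ly)) Ux Ix wL wU wI.
have same A B (AP : C2_plus A) (BP : C2_plus B) (Ax : bd A x) (Bx : bd B x) :
    outer_normal A x = outer_normal B x -> weingarten_mx A x = weingarten_mx B x ->
    f A x = f B x.
  move=> NE WE; have wA := weingarten_mxP n_ge2 AP Ax.
  by apply: (affine_density_weingarten p m k i n_ge2 AP BP Ax Bx NE wA);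
    rewrite WE; exact: weingarten_mxP.
have [[WU WI]|[WU WI]] := eq_pairs_of_mem eU eI eK eL.
- have E1 := same _ _ UP KP Ux Kx NU WU; have E2 := same _ _ IP LP Ix Lx (etrans NI (esym NL)) WI.
  exact: (congr2 +%R E1 E2).
- have E1 := same _ _ UP LP Ux Lx (etrans NU (esym NL)) WU; have E2 := same _ _ IP KP Ix Kx NI WI.
  rewrite E1 E2; exact: addrC.
Qed.

Lemma integral_boundary_split (M : set 'rV[R]_n) (A B D : set 'rV[R]_n) :
  C2_plus_centered M -> bd M = A `|` B `|` D ->
  (@hausdorff_outer R n n.-1).-caratheodory A ->
  (@hausdorff_outer R n n.-1).-caratheodory B ->
  (@hausdorff_outer R n n.-1).-caratheodory D ->
  A `&` B = set0 -> A `&` D = set0 -> B `&` D = set0 ->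
  (\int[mu]_(x in bd M) (f M x)%:E = \int[mu]_(x in A) (f M x)%:E +
    \int[mu]_(x in B) (f M x)%:E + \int[mu]_(x in D) (f M x)%:E)%E.
Proof.
move=> MC ME mA mB mD AB AD BD.
have mf := affine_density_measurable n_ge2 p m k i MC (@open_hausdorff_measurable R n n.-1).
have f0 x : bd M x -> (0 <= (f M x)%:E)%E.
  by move=> Mx; rewrite lee_fin affine_density_ge0.
rewrite ME in mf f0 *.
have mAB := caratheodory_measurable_setU mA mB.
have mfE : measurable_fun (A `|` B `|` D : set (caratheodory_type (@hausdorff_outer R n n.-1)))
    (fun x => (f M x)%:E) by exact/measurable_EFinP.
have mfAB : measurable_fun (A `|` B : set (caratheodory_type (@hausdorff_outer R n n.-1)))
    (fun x => (f M x)%:E).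
  by apply: measurable_funS mfE; [exact: caratheodory_measurable_setU|exact: subsetUl].
have f0AB x : (A `|` B) x -> (0 <= (f M x)%:E)%E by move=> ABx; apply: f0; left.
have dABD : [disjoint A `|` B & D] by rewrite disj_set2E setIUl AD BD setU0.
have dAB : [disjoint A & B] by rewrite disj_set2E AB.
have e1 := ge0_integral_setU mu mAB mD mfE f0 dABD.
have e2 := ge0_integral_setU mu mA mB mfAB f0AB dAB.
by rewrite -e2; exact: e1.
Qed.

Lemma affine_surface_area_valuation :
  (affine_surface_area p m k i (K `|` L) + affine_surface_area p m k i (K `&` L) =
   affine_surface_area p m k i K + affine_surface_area p m k i L)%E.
Proof.
pose mo := @open_hausdorff_measurable R n n.-1.
have mclosed (A : set 'rV[R]_n) : closed A -> (@hausdorff_outer R n n.-1).-caratheodory A.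
  by move=> cA; rewrite -(setCK A); apply/caratheodory_measurable_setC/mo/closed_openC.
have mbd (A : set 'rV[R]_n) : (@hausdorff_outer R n n.-1).-caratheodory (bd A).
  apply: caratheodory_measurable_setD; first exact/mclosed/closed_closure.
  exact/mo/open_interior.
pose D := bd K `&` bd L.
have mD : (@hausdorff_outer R n n.-1).-caratheodory D.
  exact: caratheodory_measurable_setI.
have clK := convex_body_closed cK; have clL := convex_body_closed cL.
have mE (A B : set 'rV[R]_n) : closed B -> (@hausdorff_outer R n n.-1).-caratheodory (bd A `\` B).
  by move=> cB; apply: caratheodory_measurable_setD => //; exact: mclosed.
have mF (A B : set 'rV[R]_n) : (@hausdorff_outer R n n.-1).-caratheodory (bd A `&` B°).
  by apply: caratheodory_measurable_setI => //; exact/mo/open_interior.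
have splitE (A B : set 'rV[R]_n) : convex_body B ->
    bd A = bd A `\` B `|` bd A `&` B° `|` bd A `&` bd B.
  move=> cB; rewrite (boundary_convex_body cB); apply/seteqP; split => x.
    move=> Ax; have [Bx|] := pselect (B x); last by left; left.
    have [Bix|] := pselect (B° x); first by left; right.
    by right.
  by move=> [[[]|[]]|[]].
have UD : (K `|` L) `&` ~` L = K `&` ~` L by rewrite setIUl setICr setU0.
have UD' : (K `|` L) `&` ~` K = L `&` ~` K by rewrite setIUl setICr set0U.
have IDK : (K `&` L) `&` L° = K `&` L°.
  by rewrite -setIA; congr (_ `&` _); apply/setIidPr; exact: interior_subset.
have IDL : (K `&` L) `&` K° = L `&` K°.
  by rewrite setIAC setIC; congr (_ `&` _); apply/setIidPr; exact: interior_subset.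
have oL := closed_openC clL; have oK := closed_openC clK.
have bUE : bd (K `|` L) = bd K `\` L `|` bd L `\` K `|` D.
  apply/seteqP; split => x.
    rewrite /D !boundary_convex_body// => -[KLx nU].
    have nK : ~ K° x by move=> h; apply: nU; apply: interiorS h; exact: subsetUl.
    have nL : ~ L° x by move=> h; apply: nU; apply: interiorS h; exact: subsetUr.
    have [Kx|nKx] := pselect (K x); have [Lx|nLx] := pselect (L x).
    - by right.
    - by left; left.
    - by left; right.
    - by case: KLx.
  move=> [[[Kx nL]|[Lx nK]]|[Kx Lx]].
  - exact: (local_boundary cK cU oL (esym UD)).
  - exact: (local_boundary cL cU oK (esym UD')).
  - by have [] := boundary_contact Kx Lx.
have bIE : bd (K `&` L) = bd K `&` L° `|` bd L `&` K° `|` D.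
  apply/seteqP; split => x; rewrite /D !boundary_convex_body// interiorI.
    move=> [[Kx Lx] nI].
    have [Ki|nK] := pselect (K° x); have [Li|nL] := pselect (L° x).
    - by case: nI.
    - by left; right.
    - by left; left.
    - by right.
  move=> [[[[Kx nK] Li]|[[Lx nL] Ki]]|[[Kx nK] [Lx nL]]]; split.
  - by split => //; exact: interior_subset.
  - by case.
  - by split => //; exact: interior_subset.
  - by case.
  - by [].
  - by case.
have eqg (g h : 'rV[R]_n -> R) (C : set 'rV[R]_n) : (forall x, C x -> g x = h x) ->
    (\int[mu]_(x in C) (g x)%:E = \int[mu]_(x in C) (h x)%:E)%E.
  by move=> gh; apply: eq_integral => x; rewrite inE => Cx; rewrite gh.
have eqf (A B C : set 'rV[R]_n) : (forall x, C x -> f A x = f B x) ->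
    (\int[mu]_(x in C) (f A x)%:E = \int[mu]_(x in C) (f B x)%:E)%E.
  by move=> AB; apply: eq_integral => x; rewrite inE => Cx; rewrite AB.
have eEK : (\int[mu]_(x in bd K `\` L) (f (K `|` L) x)%:E =
    \int[mu]_(x in bd K `\` L) (f K x)%:E)%E.
  by apply: eqf => x [Kx nL]; rewrite (local_affine_density _ _ _ _ cK cU oL (esym UD)).
have eEL : (\int[mu]_(x in bd L `\` K) (f (K `|` L) x)%:E =
    \int[mu]_(x in bd L `\` K) (f L x)%:E)%E.
  by apply: eqf => x [Lx nK]; rewrite (local_affine_density _ _ _ _ cL cU oK (esym UD')).
have eFK : (\int[mu]_(x in bd K `&` L°) (f (K `&` L) x)%:E =
    \int[mu]_(x in bd K `&` L°) (f K x)%:E)%E.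
  by apply: eqf => x [Kx Li];
    rewrite (local_affine_density _ _ _ _ cK cI (@open_interior _ L) (esym IDK)).
have eFL : (\int[mu]_(x in bd L `&` K°) (f (K `&` L) x)%:E =
    \int[mu]_(x in bd L `&` K°) (f L x)%:E)%E.
  by apply: eqf => x [Lx Ki];
    rewrite (local_affine_density _ _ _ _ cL cI (@open_interior _ K) (esym IDL)).
have DU x : D x -> bd (K `|` L) x by move=> [Kx Lx]; have [] := boundary_contact Kx Lx.
have DI x : D x -> bd (K `&` L) x by move=> [Kx Lx]; have [] := boundary_contact Kx Lx.
have fD (A B : set 'rV[R]_n) : C2_plus_centered A -> C2_plus_centered B ->
    D `<=` bd A -> D `<=` bd B ->
    (\int[mu]_(x in D) (f A x)%:E + \int[mu]_(x in D) (f B x)%:E =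
     \int[mu]_(x in D) (f A x + f B x)%:E)%E.
  move=> AC BC DA DB.
  have mfD (C : set 'rV[R]_n) : C2_plus_centered C -> D `<=` bd C ->
      measurable_fun (D : set (caratheodory_type (@hausdorff_outer R n n.-1)))
        (fun x => (f C x)%:E).
    move=> CC DC; apply/measurable_EFinP.
    by apply: measurable_funS (affine_density_measurable n_ge2 p m k i CC mo); first exact: mbd.
  have f0 (C : set 'rV[R]_n) x : C2_plus_centered C -> D `<=` bd C -> D x -> (0 <= (f C x)%:E)%E.
    by move=> CC DC /DC Cx; rewrite lee_fin affine_density_ge0.
  have := ge0_integralD mu mD (fun x => f0 A x AC DA) (mfD A AC DA)
    (fun x => f0 B x BC DB) (mfD B BC DB).
  exact: esym.
have DK : D `<=` bd K by exact: subIsetl.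
have DL : D `<=` bd L by exact: subIsetr.
have eD : (\int[mu]_(x in D) (f (K `|` L) x)%:E + \int[mu]_(x in D) (f (K `&` L) x)%:E =
    \int[mu]_(x in D) (f K x)%:E + \int[mu]_(x in D) (f L x)%:E)%E.
  apply: (etrans (fD _ _ UC IC DU DI)); apply: (etrans _ (esym (fD _ _ KC LC DK DL))).
  apply: (eqg (fun x => f (K `|` L) x + f (K `&` L) x) (fun x => f K x + f L x)) => x [Kx Lx].
  exact: affine_density_contact.
have disj (A B : set 'rV[R]_n) : (forall x, A x -> B x -> False) -> A `&` B = set0.
  by move=> AB; rewrite -subset0 => x [Ax Bx]; exact: (AB x).
have nIK x : bd K x -> ~ K° x := @boundary_not_interior _ _ _ cK x.
have nIL x : bd L x -> ~ L° x := @boundary_not_interior _ _ _ cL x.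
have inK x : bd K x -> K x := @boundary_mem _ _ _ cK x.
have inL x : bd L x -> L x := @boundary_mem _ _ _ cL x.
have EF (A B : set 'rV[R]_n) : (bd A `\` B) `&` (bd A `&` B°) = set0.
  by apply: disj => x [_ nB] [_ /interior_subset].
have sU := integral_boundary_split UC bUE (mE K L clL) (mE L K clK) mD.
have sI := integral_boundary_split IC bIE (mF K L) (mF L K) mD.
have sK := integral_boundary_split KC (splitE K L cL) (mE K L clL) (mF K L) mD (EF K L).
have bLE : bd L = bd L `\` K `|` bd L `&` K° `|` D by rewrite /D (setIC (bd K)); exact: splitE.
have sL := integral_boundary_split LC bLE (mE L K clK) (mF L K) mD (EF L K).
have dEK : (bd K `\` L) `&` D = set0.
  by apply: disj => x [_ nL] [_ Lx]; exact: nL (inL x Lx).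
have dEL : (bd L `\` K) `&` D = set0.
  by apply: disj => x [_ nK] [Kx _]; exact: nK (inK x Kx).
have dFK : (bd K `&` L°) `&` D = set0.
  by apply: disj => x [_ Li] [_ Lx]; exact: nIL x Lx Li.
have dFL : (bd L `&` K°) `&` D = set0.
  by apply: disj => x [_ Ki] [Kx _]; exact: nIK x Kx Ki.
have dE : (bd K `\` L) `&` (bd L `\` K) = set0.
  by apply: disj => x [Kx _] [_ nK]; exact: nK (inK x Kx).
have dF : (bd K `&` L°) `&` (bd L `&` K°) = set0.
  by apply: disj => x [Kx _] [_ Ki]; exact: nIK x Kx Ki.
have {}sU := sU dE dEK dEL; rewrite eEK eEL in sU.
have {}sI := sI dF dFK dFL; rewrite eFK eFL in sI.
exact: (ereal_sum_regroup sU sI (sK dEK dFK) (sL dEL dFL) eD).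
Qed.

End Valuation.

Unset Implicit Arguments.

Theorem proposition3p1 (R : realType) (n : nat) (n_ge2 : (2 <= n)%N)
    (k m : nat) (i : 'I_n -> nat)
    (weight_i : (\sum_(j < n | (1 <= j)%N) j * i j = m)%N)
    (p : R) (p_neq : p <> - n%:R) :
  (forall K L : set 'rV[R]_n,
     C2_plus_centered K -> C2_plus_centered L ->
     C2_plus_centered (K `|` L) -> C2_plus_centered (K `&` L) ->
     (affine_surface_area p m k i (K `|` L)
        + affine_surface_area p m k i (K `&` L)
      = affine_surface_area p m k i K + affine_surface_area p m k i L)%E) /\
  (forall (a : R) (K : set 'rV[R]_n), 0 < a -> C2_plus_centered K ->
     affine_surface_area p m k i [set a *: x | x in K] =
     ((a `^ (n%:R * ((n%:R - p) / (n%:R + p)) - k%:R))%:E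
        * affine_surface_area p m k i K)%E) /\
  (forall (Q : 'M[R]_n) (K : set 'rV[R]_n), Q *m Q^T = 1%:M ->
     C2_plus_centered K ->
     affine_surface_area p m k i [set x *m Q | x in K] =
     affine_surface_area p m k i K).
Proof.
split=> [K L KC LC UC IC|]; first exact: affine_surface_area_valuation.
split=> [a K a0 KC|Q K QQ KC].
  have QQ : (1%:M : 'M[R]_n) *m (1%:M)^T = 1%:M by rewrite trmx1 mulmx1.
  rewrite -(affine_surface_area_similarity n_ge2 a0 QQ k p_neq weight_i KC).
  by congr affine_surface_area; apply: eq_imagel => x _; rewrite /similarity mulmx1.
have := affine_surface_area_similarity n_ge2 ltr01 QQ k p_neq weight_i KC.
rewrite powR1 mul1e => <-.
by congr affine_surface_area; apply: eq_imagel => x _; rewrite /similarity scale1r.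
Qed.
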